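(* Let $I=(I_-,I_+)\subset\mathbb R$ be a nonempty open interval with closure $\overline I=[I_-,I_+]\subset[-\infty,\infty]$, and let $\lambda_\pm:\overline I\to[0,\infty)$ be continuous functions such that $\lambda_-$ is nonincreasing, $\lambda_+$ is nondecreasing, $\lambda_+(I_-)>0$ and $\lambda_-(I_+)>0$. Let $(f_-,f_+)$ be the unique solution to Luckock's equation. Then, for each $z\in\overline I$, there exists a unique pair of weight functions $(w^{z,-}_-,w^{z,-}_+)=(w_-,w_+)$ such that the linear functional $F^{z,-}=F$ defined by $$F(\mathcal X):=\int_Iw_-(x)\,\mathcal X^-(\mathrm dx)+\int_Iw_+(x)\,\mathcal X^+(\mathrm dx)\qquad(\mathcal X\in\mathcal S^{\rm fin}_{\rm ord})$$ satisfies $$GF(\mathcal X)=1_{\{M_-(\mathcal X)\le z\}}-f_-(z)\qquad(\mathcal X\in\mathcal S^{\rm fin}_{\rm ord}).$$ Likewise, for each $z\in\overline I$ there exists a unique pair of weight functions $(w^{z,+}_-,w^{z,+}_+)=(w_-,w_+)$ such that the linear functional $F^{z,+}=F$ defined by the same formula satisfies $$GF(\mathcal X)=1_{\{M_+(\mathcal X)\ge z\}}-f_+(z)\qquad(\mathcal X\in\mathcal S^{\rm fin}_{\rm ord}).$$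
   Context: **Weight functions.** A pair of weight functions is a pair of bounded functions $w_\pm:\overline I\to\mathbb R$ such that $w_-$ is left-continuous (on $(I_-,I_+]$), $w_+$ is right-continuous (on $[I_-,I_+)$), and, by convention, $w_-(I_-)=0$ and $w_+(I_+)=0$. **Luckock's equation.** For continuous $f:\overline I\to\mathbb R$ of bounded variation, $\mathrm df$ is the atomless signed measure on $\overline I$ with $\mathrm df((x,y])=f(y)-f(x)$; $g\,\mathrm df$ is $\mathrm df$ weighted with density $g$. A solution to Luckock's equation is a pair $(f_-,f_+)$ of continuous functions of bounded variation on $\overline I$ such that $f_-\,\mathrm d\lambda_++\lambda_-\,\mathrm df_+=0$, $f_+\,\mathrm d\lambda_-+\lambda_+\,\mathrm df_-=0$, and $f_-(I_+)=1=f_+(I_-)$. Under the stated hypotheses it is a fact that there is exactly one solution. **Generator.** Let $\mu_\pm$ be the finite measures on $\overline I$ with $\mu_-([x,I_+])=\lambda_-(x)$ and $\mu_+([I_-,x])=\lambda_+(x)$ for $x\in\overline I$, and let $\mu$ be the measure on $\overline I\times\{-,+\}$ with $\mu(A\times\{\sigma\})=\mu_\sigma(A)$. $\mathcal S^{\rm fin}_{\rm ord}$ is the set of all $\mathcal X=\mathcal X^+-\mathcal X^-$, where $\mathcal X^\pm$ are finite sums of delta measures on $I$ such that there are no $x\le y$ in $I$ with $\mathcal X^+(\{x\})>0$ and $\mathcal X^-(\{y\})>0$. Put $$M_-(\mathcal X):=\max(\{I_-\}\cup\{x\in I:\mathcal X(\{x\})<0\}),\quad M_+(\mathcal X):=\min(\{I_+\}\cup\{x\in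 I:\mathcal X(\{x\})>0\}).$$ For $(u,\sigma)\in\overline I\times\{-,+\}$ the Luckock map $L_{u,\sigma}$ is: $L_{u,-}(\mathcal X)=\mathcal X-\delta_{u\wedge M_+(\mathcal X)}$ if $u\wedge M_+(\mathcal X)\in I$; $L_{u,+}(\mathcal X)=\mathcal X+\delta_{u\vee M_-(\mathcal X)}$ if $u\vee M_-(\mathcal X)\in I$; and $L_{u,\sigma}(\mathcal X)=\mathcal X$ otherwise. For $F$ as in the claim, $GF(\mathcal X):=\int\{F(L_{u,\sigma}(\mathcal X))-F(\mathcal X)\}\,\mu(\mathrm d(u,\sigma))$. *)

(* Defs.v *)
From HB Require Import structures.
From mathcomp Require Import all_boot all_order all_algebra.
From mathcomp Require Import all_classical all_reals all_analysis.
From mathcomp Require Import measurable_realfun.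

Set Implicit Arguments.
Unset Strict Implicit.
Unset Printing Implicit Defensive.

Import Order.TTheory GRing.Theory Num.Theory.
Import numFieldNormedType.Exports.

Local Open Scope classical_set_scope.
Local Open Scope ring_scope.

(* The interval I = (I_-, I_+) is `]a, b[ for a < b in \bar R, its closure is
   `[a, b]. A function on the closure is a map \bar R -> R of which only the
   values on `[a, b] are used; a (signed) measure on the closure is a measure
   (charge) on \bar R that vanishes off `[a, b]. The sign + is true, the sign -
   is false. *)

Section jordan_parts.
Context d (T : measurableType d) (R : realType).
Implicit Type nu : {charge set T -> \bar R}.

Let hahnP nu := projT2 (cid (projT2 (cid (Hahn_decomposition nu)))).

(* The choice of Hahn decomposition does not affect the values on measurable
   sets, by Hahn_decomposition_uniq. *)
Definition charge_pos nu : {measure set T -> \bar R} := jordan_pos (hahnP nu).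

Definition charge_neg nu : {measure set T -> \bar R} := jordan_neg (hahnP nu).

Definition charge_integral nu (A : set T) (g : T -> R) : R :=
  \int[charge_pos nu]_(x in A) g x - \int[charge_neg nu]_(x in A) g x.

End jordan_parts.

Section luckock.
Context (R : realType) (a b : \bar R).
Implicit Types (f g w wm wp : \bar R -> R) (x y z u : \bar R).
Implicit Types X : {charge set (\bar R) -> \bar R}.

(* One-sided limits are spelled out because at_left and at_right are only
   available on fields. *)
Definition weight_functions wm wp : Prop :=
  [/\ exists M : R, forall x, x \in `[a, b] -> `|wm x| <= M /\ `|wp x| <= M,
      forall x, x \in `]a, b] -> wm @ within [set y | (y < x)%E] (nbhs x) --> wm x,
      forall x, x \in `[a, b[ -> wp @ within [set y | (x < y)%E] (nbhs x) --> wp x,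
      wm a = 0 & wp b = 0].

Definition bounded_variation_on f : Prop :=
  exists M : R, forall s : seq (\bar R), path <%O a s -> last a s = b ->
    \sum_(p <- zip (a :: s) s) `|f p.2 - f p.1| <= M.

(* nu is the atomless signed measure df of f *)
Definition is_differential f (nu : {charge set (\bar R) -> \bar R}) : Prop :=
  [/\ forall A, measurable A -> A `&` `[a, b] = set0 -> nu A = 0%E,
      forall x, nu [set x] = 0%E
    & forall x y, x \in `[a, b] -> y \in `[a, b] -> (x <= y)%E ->
        nu `]x, y]%classic = (f y - f x)%:E].

Definition luckock_solution (lm lp fm fp : \bar R -> R) : Prop :=
  [/\ {within `[a, b], continuous fm} /\ {within `[a, b], continuous fp},
      bounded_variation_on fm /\ bounded_variation_on fp,
      exists dlm dlp dfm dfp : {charge set (\bar R) -> \bar R},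
        [/\ is_differential lm dlm /\ is_differential lp dlp,
            is_differential fm dfm /\ is_differential fp dfp,
            forall A, measurable A -> A `<=` `[a, b] ->
              charge_integral dlp A fm + charge_integral dfp A lm = 0
          & forall A, measurable A -> A `<=` `[a, b] ->
              charge_integral dlm A fp + charge_integral dfm A lp = 0]
    & fm b = 1 /\ fp a = 1].

Definition is_order_measure (lm lp : \bar R -> R)
    (mu : {measure set (\bar R * bool) -> \bar R}) : Prop :=
  exists mum mup : {finite_measure set (\bar R) -> \bar R},
    [/\ mum (~` `[a, b]) = 0%E /\ mup (~` `[a, b]) = 0%E,
        forall x, x \in `[a, b] -> mum `[x, b]%classic = (lm x)%:E,
        forall x, x \in `[a, b] -> mup `[a, x]%classic = (lp x)%:E
      & forall A, measurable A -> mu (A `*` [set false]) = mum A /\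
                                 mu (A `*` [set true]) = mup A].

Definition deltas (s : seq (\bar R)) : {measure set (\bar R) -> \bar R} :=
  msum (fun i => \d_(nth 0%E s i)) (size s).

Definition Sord_fin X : Prop :=
  exists sp sm : seq (\bar R),
    [/\ {subset sp <= `]a, b[} /\ {subset sm <= `]a, b[},
        forall x y, x \in `]a, b[ -> y \in `]a, b[ -> (x <= y)%E ->
          ~ ((0 < deltas sp [set x])%E /\ (0 < deltas sm [set y])%E)
      & forall A, measurable A -> X A = (deltas sp A - deltas sm A)%E].

(* For X in Sord_fin the sets below are finite, so that the supremum and the
   infimum are a maximum and a minimum. *)
Definition Mminus X : \bar R :=
  ereal_sup ([set a] `|` [set x | (x \in `]a, b[) /\ (X [set x] < 0)%E]).

Definition Mplus X : \bar R :=
  ereal_inf ([set b] `|` [set x | (x \in `]a, b[) /\ (0 < X [set x])%E]).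

Definition add_delta X y : {charge set (\bar R) -> \bar R} :=
  cadd X (charge_of_finite_measure \d_y).

Definition sub_delta X y : {charge set (\bar R) -> \bar R} :=
  cadd X (copp (charge_of_finite_measure \d_y)).

Definition luckock_map (p : \bar R * bool) X : {charge set (\bar R) -> \bar R} :=
  if p.2 then
    let y := maxe p.1 (Mminus X) in if y \in `]a, b[ then add_delta X y else X
  else
    let y := mine p.1 (Mplus X) in if y \in `]a, b[ then sub_delta X y else X.

(* The two finite sums of delta measures in the decomposition of X in Sord_fin
   have no common atom: they are the Jordan components of X. *)
Definition linear_functional wm wp X : R :=
  \int[charge_neg X]_(x in `]a, b[) wm x + \int[charge_pos X]_(x in `]a, b[) wp x.

Definition generator (mu : {measure set (\bar R * bool) -> \bar R})
    (F : {charge set (\bar R) -> \bar R} -> R) X : R :=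
  \int[mu]_(p in `[a, b] `*` setT) (F (luckock_map p X) - F X).

(* Uniqueness is as functions on `[a, b]. *)
Definition exists_unique_weights
    (P : (\bar R -> R) -> (\bar R -> R) -> Prop) : Prop :=
  exists wm wp, [/\ weight_functions wm wp, P wm wp
    & forall vm vp, weight_functions vm vp -> P vm vp ->
        {in `[a, b], vm =1 wm} /\ {in `[a, b], vp =1 wp}].

End luckock.

(* Main.v *)
(* One event changes a linear functional [F] by an amount that depends only on
   whether the event falls beyond [M_+] (or [M_-]), so [GF] splits as
   [Phi_+(M_+) + Phi_-(M_-)], where

     Phi_+(y) = - int_(a,y) w_- dlm - w_+(y) lm(y),
     Phi_-(x) =   int_(x,b) w_+ dlp - w_-(x) lp(x),

   and every pair [a <= x < y <= b] occurs as [(M_-, M_+)]. The target therefore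
   prescribes [Phi_+] and [Phi_-] up to constants. Where they are constant,
   [(w_+ lm, w_- lp)] solves Luckock's equation [df = - g/lp dlm],
   [dg = - f/lm dlp]. This system has the first integral [f lp + g lm], whose
   sign decides whether [f/lm] increases or decreases; hence only the zero
   solution has [f b = g a = 0], which is uniqueness of the weights. For
   existence, [(lm, -lp)] and [(fm, fp)] span the solutions; the boundary
   conditions leave one free coefficient on each side of [z], and the two jumps
   at [z] form a linear system whose determinant is nonzero since
   [fm lp + fp lm > 0].

   The Stieltjes calculus behind this rests on one principle: a function whose
   increments near each point are negligible with respect to those of a monotone
   function is constant. *)

Require Import Defs.
From HB Require Import structures.
From mathcomp Require Import all_boot all_order all_algebra.
From mathcomp Require Import all_classical all_reals all_analysis.
From mathcomp Require Import measurable_realfun.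
From mathcomp Require Import ring lra.

Import Order.TTheory GRing.Theory Num.Theory.
Import numFieldNormedType.Exports.

Local Open Scope classical_set_scope.
Local Open Scope ring_scope.

Set Implicit Arguments.
Unset Strict Implicit.
Unset Printing Implicit Defensive.

(** * Intervals of the extended real line *)

(** The principle about negligible increments replaces integration by parts. The first integral and
    the monotonicity of [f / lm] are Leibniz rules for products and quotients. For increments these
    are algebraic identities up to a remainder, which is negligible by continuity. The endpoints
    need care throughout. The minus measure has an atom of mass [lm b] at [b] and the plus measure
    one of mass [lp a] at [a], so integrals run over open intervals and the atoms are accounted for
    separately. The values of [w_-] at [b] and of [w_+] at [a] enter no rate at a possible value of
    [M_-] or [M_+]; only one-sided continuity determines them. For existence, the two jumps at [z]
    use up both free coefficients, so the additive constant can no longer be chosen. It has the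
    required value because the first integral can be read off at both ends, where [f_-] or [f_+] is
    normalized to 1. This is where the terms [f_-(z)] and [f_+(z)] come from. *)

Lemma ereal_rat_between (R : realType) (x y : \bar R) : (x < y)%E ->
  exists q : rat, (x < (ratr q)%:E)%E && ((ratr q)%:E < y)%E.
Proof.
case: x y => [x| |] [y| |] //= xy.
- by have [q /[!in_itv]/= xqy] := rat_in_itvoo xy; exists q; rewrite !lte_fin.
- have /rat_in_itvoo[q /[!in_itv]/= /andP[xq _]] : x < x + 1 by rewrite ltrDl.
  by exists q; rewrite lte_fin xq ltry.
- have /rat_in_itvoo[q /[!in_itv]/= /andP[_ qy]] : y - 1 < y by rewrite gtrBl.
  by exists q; rewrite lte_fin qy ltNyr.
- by exists 0; rewrite ltNyr ltry.
Qed.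

Section intervals.
Context (R : realType).
Implicit Types (t u v x y : \bar R) (U : set (\bar R)).

Lemma itv_convex (i : interval (\bar R)) x y u : x \in i -> y \in i ->
  (x <= u)%E -> (u <= y)%E -> u \in i.
Proof.
case: i => l r; rewrite !itv_boundlr => /andP[lx _] /andP[_ yr] xu uy; apply/andP; split.
  by rewrite (le_trans lx)// bnd_simp.
by rewrite (le_trans _ yr)// bnd_simp.
Qed.

(** Intervals form a base of neighbourhoods and contain every point between two of their points.
    This upgrades a property near [t] to one on whole segments from [t], which is what estimates on
    intervals ask for. *)
Lemma nbhs_convex t U : nbhs t U ->
  \forall y \near t, forall u, (t <= u <= y)%E \/ (y <= u <= t)%E -> U u.
Proof.
rewrite itv_nbhsE => -[i [io ti] iU].
suff: nbhs t [set y | forall u, (t <= u <= y)%E \/ (y <= u <= t)%E -> U u] by [].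
rewrite itv_nbhsE; exists i => // y /= yi u [|] /andP[h1 h2]; apply: iU => /=.
  exact: (itv_convex ti yi).
exact: (itv_convex yi ti).
Qed.

Lemma nbhs_left_exists t x U : nbhs t U -> (x < t)%E ->
  exists u, [/\ (x < u)%E, (u < t)%E & U u].
Proof.
rewrite itv_nbhsE => -[[l r] [io ti] iU] xt.
(* [y] is the larger of [x] and the left end of the open interval inside [U], so every point between
   [y] and [t] works. *)
have [y [xy yt yl]] : exists y, [/\ (x <= y)%E, (y < t)%E &
    (l <= BRight y)%O].
  case: l io ti {iU} => [[] l|[|]] io ti /=.
  - by case: r io ti => [[]|[]].
  - move: ti; rewrite itv_boundlr => /andP[]; rewrite bnd_simp => lt _.
    by exists (maxe x l); rewrite bnd_simp le_max lexx gt_max xt lt le_max lexx orbT.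
  - by exists x.
  - by move: ti; rewrite itv_boundlr => /andP[].
have [q /andP[yq qt]] := ereal_rat_between yt.
exists (ratr q)%:E; split => //; first exact: le_lt_trans yq.
apply: iU => /=; move: ti; rewrite !itv_boundlr => /andP[_ tr]; apply/andP; split.
  by rewrite (le_trans yl)// bnd_simp.
by rewrite (le_trans _ tr)// bnd_simp ltW.
Qed.

Lemma nbhs_right_exists t x U : nbhs t U -> (t < x)%E ->
  exists u, [/\ (t < u)%E, (u < x)%E & U u].
Proof.
rewrite itv_nbhsE => -[[l r] [io ti] iU] tx.
have [y [ty yx yr]] : exists y, [/\ (t < y)%E, (y <= x)%E &
    (BLeft y <= r)%O].
  case: r io ti {iU} => [[] r|[|]] io ti /=.
  - move: ti; rewrite itv_boundlr => /andP[_]; rewrite bnd_simp => tr.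
    by exists (mine x r); rewrite bnd_simp lt_min tx tr !ge_min lexx lexx orbT.
  - by case: l io ti => [[]|[]].
  - by move: ti; rewrite itv_boundlr => /andP[].
  - by exists x.
have [q /andP[tq qy]] := ereal_rat_between ty.
exists (ratr q)%:E; split => //; first exact: lt_le_trans yx.
apply: iU => /=; move: ti; rewrite !itv_boundlr => /andP[tl _]; apply/andP; split.
  by rewrite (le_trans tl)// bnd_simp ltW.
by rewrite (le_trans _ yr)// bnd_simp.
Qed.

(* The infinitesimal inequality propagates from [x] to the supremum of the
   points that it reaches, and beyond it. *)
Lemma locally_nonincreasing (a b : \bar R) (h V : \bar R -> R) :
  (forall t (e : R), t \in `[a, b] -> 0 < e ->
    \forall y \near t, y \in `[a, b] ->
      ((t <= y)%E -> h y - h t <= e * (V y - V t)) /\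
      ((y <= t)%E -> h t - h y <= e * (V t - V y))) ->
  {in `[a, b] &, forall x y, (x <= y)%E -> h y <= h x}.
Proof.
move=> loc x y; rewrite !in_itv/= => /andP[ax xb] /andP[ay yb] xy.
have main e : 0 < e -> h y - h x <= e * (V y - V x).
  move=> e0.
  pose S := [set u | (x <= u <= y)%E /\ h u - h x <= e * (V u - V x)].
  have Sx : S x by split; rewrite ?lexx ?xy// !subrr mulr0.
  pose s := ereal_sup S.
  have xs : (x <= s)%E by apply: ereal_sup_ubound.
  have sy : (s <= y)%E by apply: ge_ereal_sup => u [/andP[]].
  have abs : s \in `[a, b].
    by rewrite in_itv/= (le_trans ax xs) (le_trans sy yb).
  have Us := nbhs_convex (loc _ _ abs e0).
  (* The backward half of the hypothesis at [s] links a point of [S] just left of [s] to [s]; below,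
     the forward half leads beyond [s] unless [s = y]. *)
  have Ss : S s.
    have [<-//|xns] := eqVneq x s.
    have {}xns : (x < s)%E by rewrite lt_neqAle xns.
    have [l [xl ls /= Ul]] := nbhs_left_exists Us xns.
    have [u Su lu] : exists2 u, S u & (l < u)%E.
      apply: contrapT => nex; move: ls; rewrite ltNge => /negP; apply.
      apply: ge_ereal_sup => u Su; rewrite leNgt; apply/negP => lu.
      by apply: nex; exists u.
    have us : (u <= s)%E by exact: ereal_sup_ubound.
    have := Ul u (or_intror _); rewrite (ltW lu) us => /(_ isT).
    case: Su => /andP[xu uy] hu.
    rewrite in_itv/= (le_trans ax xu) (le_trans uy yb) => /(_ isT)[_ /(_ isT) hs].
    split; first by rewrite xs sy.
    by nra.
  move: sy; rewrite le_eqVlt => /predU1P[sy|sy]; first by rewrite -sy; case: Ss.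
  have [u [su uy /= Uu]] := nbhs_right_exists Us sy.
  have := Uu u (or_introl _); rewrite (ltW su) lexx => /(_ isT).
  rewrite in_itv/= (le_trans ax (le_trans xs (ltW su))).
  rewrite (le_trans (ltW uy) yb) => /(_ isT)[/(_ isT) hu _].
  suff /ereal_sup_ubound : S u by rewrite leNgt su.
  split; first by rewrite (le_trans xs (ltW su)) ltW.
  by case: Ss => _ hs; nra.
(* Let [e] be small: if [h x < h y], then [e = (h y - h x) / c] with [c] above the increment of [V]
   contradicts [main]. *)
rewrite -subr_le0 leNgt; apply/negP => h0.
pose c := `|V y - V x| + 1.
have c0 : 0 < c by rewrite ltr_wpDl.
have /main : 0 < (h y - h x) / c by rewrite divr_gt0.
apply/negP; rewrite -ltNge mulrAC ltr_pdivrMr//.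
by rewrite ltr_pM2l// (le_lt_trans (ler_norm _))// ltrDl.
Qed.

End intervals.

(** * Increments negligible with respect to a monotone function *)

Section infinitesimals.
Context (R : realType) (a b : \bar R).
Implicit Types (t u x y : \bar R) (f g h w L V G phi : \bar R -> R).

Lemma within_near f t (e : R) : {within `[a, b], continuous f} ->
  t \in `[a, b] -> 0 < e ->
  \forall y \near t, y \in `[a, b] -> `|f y - f t| <= e.
Proof.
move=> /subspace_continuousP cf tab e0.
have /cvgrPdist_le /(_ _ e0) := cf t tab.
by rewrite near_withinE; apply: filterS => y yab /yab; rewrite distrC.
Qed.

Lemma within_div f g : {within `[a, b], continuous f} ->
  {within `[a, b], continuous g} -> {in `[a, b], forall x, g x != 0} ->
  {within `[a, b], continuous (fun x => f x / g x)}.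
Proof.
move=> /subspace_continuousP cf /subspace_continuousP cg g0.
apply/subspace_continuousP => x xab.
by apply: cvgM; [exact: cf|apply: cvgV; [exact: g0|exact: cg]].
Qed.

(** This is [phi = o(V - V t)] at [t], without division: where [V] takes the value [V t] near [t],
    [phi] has to vanish. *)
Definition osmall V t phi := forall e : R, 0 < e ->
  \forall y \near t, y \in `[a, b] -> `|phi y| <= e * `|V y - V t|.

Lemma osmall_le V1 V2 t phi : osmall V1 t phi ->
  {in `[a, b], forall y, `|V1 y - V1 t| <= `|V2 y - V2 t|} -> osmall V2 t phi.
Proof.
move=> o V12 e e0; apply: filterS (o e e0) => y oy yab.
by rewrite (le_trans (oy yab))// ler_pM2l// V12.
Qed.

Lemma osmall_ext V t phi1 phi2 : {in `[a, b], phi1 =1 phi2} ->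
  osmall V t phi1 -> osmall V t phi2.
Proof.
move=> eq12 o e e0; apply: filterS (o e e0) => y oy yab.
by rewrite -eq12// oy.
Qed.

Lemma osmallD V t phi1 phi2 : osmall V t phi1 -> osmall V t phi2 ->
  osmall V t (fun y => phi1 y + phi2 y).
Proof.
move=> o1 o2 e e0; have e20 : 0 < e / 2 by rewrite divr_gt0.
apply: filterS2 (o1 _ e20) (o2 _ e20) => y h1 h2 yab.
have := ler_normD (phi1 y) (phi2 y); have := h1 yab; have := h2 yab; lra.
Qed.

Lemma osmallM V t phi g (M : R) : osmall V t phi ->
  (\forall y \near t, y \in `[a, b] -> `|g y| <= M) ->
  osmall V t (fun y => g y * phi y).
Proof.
move=> o gM e e0.
have M10 : 0 < `|M| + 1 by rewrite ltr_wpDl.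
apply: filterS2 gM (o _ (divr_gt0 e0 M10)) => y h1 h2 yab.
rewrite normrM.
apply: (@le_trans _ _ ((`|M| + 1) * (e / (`|M| + 1) * `|V y - V t|))).
  by rewrite ler_pM ?h2// (le_trans (h1 yab))// (le_trans (ler_norm _))// lerDl.
by rewrite mulrA mulrCA divff ?gt_eqF// mulr1.
Qed.

Lemma osmallZ V t phi (c : R) : osmall V t phi ->
  osmall V t (fun y => c * phi y).
Proof. by move=> o; apply: (osmallM (M := `|c|) o); exact: nearW. Qed.

(** This is the second-order term of the product rule; continuity of one factor suffices to discard
    it. *)
Lemma osmall_increments V t f : {within `[a, b], continuous f} ->
  t \in `[a, b] -> osmall V t (fun y => (f y - f t) * (V y - V t)).
Proof.
move=> cf tab e e0; apply: filterS (within_near cf tab e0) => y fy yab.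
by rewrite normrM ler_wpM2r ?fy.
Qed.

(** [D t y] plays the differential of [h] at [t]: its sign decides the direction in which [h] moves,
    since the rest is negligible. *)
Lemma osmall_nonincreasing V h (D : \bar R -> \bar R -> R) :
  {in `[a, b] &, forall x y, (x <= y)%E -> V x <= V y} ->
  {in `[a, b], forall t, osmall V t (fun y => h y - h t - D t y)} ->
  {in `[a, b] &, forall t y, (t <= y)%E -> D t y <= 0} ->
  {in `[a, b] &, forall t y, (y <= t)%E -> 0 <= D t y} ->
  {in `[a, b] &, forall x y, (x <= y)%E -> h y <= h x}.
Proof.
move=> Vle oh Dle Dge; apply: (@locally_nonincreasing _ _ _ _ V) => t e tab e0.
apply: filterS (oh t tab e e0) => y hy yab; have {}hy := hy yab.
split=> [ty|yt].
  move: hy; rewrite [`|V _ - _|]ger0_norm ?subr_ge0 ?Vle//.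
  have := ler_norm (h y - h t - D t y); have := Dle t y tab yab ty; lra.
move: hy; rewrite [`|V _ - _|]ler0_norm ?subr_le0 ?Vle// opprB.
have := ler_norm (- (h y - h t - D t y)); rewrite normrN.
have := Dge t y tab yab yt; lra.
Qed.

Lemma osmall_constant V h :
  {in `[a, b] &, forall x y, (x <= y)%E -> V x <= V y} ->
  {in `[a, b], forall t, osmall V t (fun y => h y - h t)} ->
  {in `[a, b] &, forall x y, h x = h y}.
Proof.
move=> Vle oh.
have noninc g : {in `[a, b], forall t, osmall V t (fun y => g y - g t)} ->
    {in `[a, b] &, forall x y, (x <= y)%E -> g y <= g x}.
  move=> og; apply: (osmall_nonincreasing (D := fun _ _ => 0) Vle) => // t tab.
  by apply: osmall_ext (og t tab) => y _; rewrite subr0.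
have {}noninc x y : x \in `[a, b] -> y \in `[a, b] -> (x <= y)%E -> h x = h y.
  move=> xab yab xy; apply/eqP; rewrite eq_le (noninc h oh x y)// andbT.
  rewrite -lerN2; apply: (noninc (fun x => - h x)) => // t tab.
  apply: osmall_ext (osmallZ (-1) (oh t tab)) => u _; ring.
move=> x y xab yab; have [xy|/ltW yx] := leP x y; first exact: noninc.
by apply/esym/noninc.
Qed.

(* [stieltjes w L V G] says that [G] is a primitive of [w dL], where [V]
   dominates the variation of [L]; the definition does not mention integrals so
   that it covers both measures and charges. *)
Definition stieltjes w L V G := {in `[a, b] &, forall x y, (x <= y)%E ->
  forall k e : R, (forall u, (x <= u <= y)%E -> `|w u - k| <= e) ->
    `|G y - G x - k * (L y - L x)| <= e * (V y - V x)}.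

(** First-order expansion of a primitive: take [k = w t], from which a continuous [w] deviates by at
    most [e] on short segments. *)
Lemma stieltjes_osmall w L V G t : {within `[a, b], continuous w} ->
  {in `[a, b] &, forall x y, (x <= y)%E -> V x <= V y} ->
  stieltjes w L V G -> t \in `[a, b] ->
  osmall V t (fun y => G y - G t - w t * (L y - L t)).
Proof.
move=> cw Vle sG tab e e0.
apply: filterS (nbhs_convex (within_near cw tab e0)) => y wy yab.
have [ty|/ltW yt] := leP t y.
  rewrite (le_trans (sG t y tab yab ty (w t) e _))//.
    move=> u /andP[tu uy]; apply: wy; first by left; rewrite tu uy.
    exact: itv_convex tab yab tu uy.
  by rewrite ler_pM2l// ler_norm.
rewrite -normrN.
have -> : - (G y - G t - w t * (L y - L t)) =
    G t - G y - w t * (L t - L y) by ring.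
rewrite (le_trans (sG y t yab tab yt (w t) e _))//.
  move=> u /andP[yu ut]; apply: wy; first by right; rewrite yu ut.
  exact: itv_convex yab tab yu ut.
by rewrite ler_pM2l// distrC ler_norm.
Qed.

Lemma stieltjesN w L V G : stieltjes w L V G ->
  stieltjes (fun x => - w x) L V (fun x => - G x).
Proof.
move=> sG x y xab yab xy k e wk.
have := sG x y xab yab xy (- k) e; rewrite -normrN.
have -> : - (G y - G x - - k * (L y - L x)) = - G y - - G x - k * (L y - L x).
  by ring.
apply=> u /wk; rewrite -normrN.
by have -> : - (- w u - k) = w u - - k by ring.
Qed.

(** This solves [p dL + q df = 0] for [df]. At each [t] the hypothesis on [G1 + G2] makes
    [p t * (L y - L t) + q t * (f y - f t)] negligible; dividing by [q t] shows that [G] and [- f]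
    have the same increments to first order. *)
Lemma differential_ratio (p q : \bar R -> R) f L V1 V2 V3 G1 G2 G :
  {within `[a, b], continuous p} -> {within `[a, b], continuous q} ->
  {in `[a, b], forall x, q x != 0} ->
  {in `[a, b] &, forall x y, (x <= y)%E -> V1 x <= V1 y} ->
  {in `[a, b] &, forall x y, (x <= y)%E -> V2 x <= V2 y} ->
  {in `[a, b] &, forall x y, (x <= y)%E -> V3 x <= V3 y} ->
  stieltjes p L V1 G1 -> stieltjes q f V2 G2 ->
  stieltjes (fun x => p x / q x) L V3 G ->
  {in `[a, b], forall x, G1 x + G2 x = 0} ->
  {in `[a, b] &, forall x y, G x + f x = G y + f y}.
Proof.
move=> cp cq q0 V1le V2le V3le s1 s2 s3 G0.
(* A common gauge for the three remainders: by monotonicity, the increments of each summand are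
   dominated by those of the sum. *)
pose V x := V1 x + V2 x + V3 x.
have Vle : {in `[a, b] &, forall x y, (x <= y)%E -> V x <= V y}.
  by move=> x y xab yab xy; rewrite !lerD ?V1le ?V2le ?V3le.
have VV (W1 W2 : \bar R -> R) : {in `[a, b] &, forall x y, (x <= y)%E -> W1 x <= W1 y} ->
    {in `[a, b] &, forall x y, (x <= y)%E -> W2 x <= W2 y} -> {in `[a, b] &,
    forall t y, `|W1 y - W1 t| <= `|W1 y + W2 y - (W1 t + W2 t)|}.
  move=> W1le W2le t y tab yab; rewrite opprD addrACA.
  have [ty|/ltW yt] := leP t y.
    have d1 : 0 <= W1 y - W1 t by rewrite subr_ge0 W1le.
    have d2 : 0 <= W2 y - W2 t by rewrite subr_ge0 W2le.
    by rewrite !ger0_norm ?(addr_ge0 d1 d2)// lerDl.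
  have d1 : W1 y - W1 t <= 0 by rewrite subr_le0 W1le.
  have d2 : W2 y - W2 t <= 0 by rewrite subr_le0 W2le.
  rewrite (ler0_norm d1) ler0_norm; lra.
apply: (osmall_constant (h := fun x => G x + f x) Vle) => t tab.
have := stieltjes_osmall cp V1le s1 tab.
have := stieltjes_osmall cq V2le s2 tab.
have := stieltjes_osmall (within_div cp cq q0) V3le s3 tab.
move=> /(@osmall_le _ V) o3 /(@osmall_le _ V) o2 /(@osmall_le _ V) o1.
have /o1 {}o1 : {in `[a, b], forall y, `|V1 y - V1 t| <= `|V y - V t|}.
  move=> y yab; have -> : V y - V t = V1 y + (V2 y + V3 y) - (V1 t + (V2 t + V3 t)).
    by rewrite /V; ring.
  by apply: (VV V1 (fun x => V2 x + V3 x)) => // u v uab vab uv /=;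
    rewrite lerD ?V2le ?V3le.
have /o2 {}o2 : {in `[a, b], forall y, `|V2 y - V2 t| <= `|V y - V t|}.
  move=> y yab; have -> : V y - V t = V2 y + (V1 y + V3 y) - (V2 t + (V1 t + V3 t)).
    by rewrite /V; ring.
  by apply: (VV V2 (fun x => V1 x + V3 x)) => // u v uab vab uv /=;
    rewrite lerD ?V1le ?V3le.
have /o3 {}o3 : {in `[a, b], forall y, `|V3 y - V3 t| <= `|V y - V t|}.
  move=> y yab; have -> : V y - V t = V3 y + (V1 y + V2 y) - (V3 t + (V1 t + V2 t)).
    by rewrite /V; ring.
  by apply: (VV V3 (fun x => V1 x + V2 x)) => // u v uab vab uv /=;
    rewrite lerD ?V1le ?V2le.
apply: osmall_ext (osmallD o3 (osmallZ (- (q t)^-1) (osmallD o1 o2))) => y yab /=.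
have G2E x : x \in `[a, b] -> G2 x = - G1 x.
  by move=> xab; apply/eqP; rewrite -addr_eq0 addrC G0.
rewrite !G2E//; field; exact: q0.
Qed.

End infinitesimals.

(** * Luckock's equation *)

Section luckock_pairs.
Context (R : realType) (a b : \bar R) (lm lp : \bar R -> R).
Hypothesis (hab : (a < b)%E).
Hypothesis (lm_cont : {within `[a, b], continuous lm}).
Hypothesis (lp_cont : {within `[a, b], continuous lp}).
Hypothesis (lm_noninc : {in `[a, b] &, forall x y, (x <= y)%E -> lm y <= lm x}).
Hypothesis (lp_nondec : {in `[a, b] &, forall x y, (x <= y)%E -> lp x <= lp y}).
Hypotheses (lp_gt0 : 0 < lp a) (lm_gt0 : 0 < lm b).
Implicit Types f g : \bar R -> R.

Lemma a_itv : a \in `[a, b]. Proof. by rewrite in_itv/= lexx ltW. Qed.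

Lemma b_itv : b \in `[a, b]. Proof. by rewrite in_itv/= lexx ltW. Qed.

Lemma ge_lm_b x : x \in `[a, b] -> lm b <= lm x.
Proof. by move=> xab; apply: lm_noninc => //; [exact: b_itv|rewrite (itvP xab)]. Qed.

Lemma ge_lp_a x : x \in `[a, b] -> lp a <= lp x.
Proof. by move=> xab; apply: lp_nondec => //; [exact: a_itv|rewrite (itvP xab)]. Qed.

Lemma lm_itv_gt0 x : x \in `[a, b] -> 0 < lm x.
Proof. by move=> /ge_lm_b; exact: lt_le_trans. Qed.

Lemma lp_itv_gt0 x : x \in `[a, b] -> 0 < lp x.
Proof. by move=> /ge_lp_a; exact: lt_le_trans. Qed.

(* Luckock's equation with the differential of each component solved for. *)
Definition luckock_pair f g :=
  [/\ {within `[a, b], continuous f}, {within `[a, b], continuous g},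
      stieltjes a b (fun x => g x / lp x) (fun x => - lm x) (fun x => - lm x) f
    & stieltjes a b (fun x => f x / lm x) lp lp (fun x => - g x)].

Lemma luckock_pairN f g : luckock_pair f g ->
  luckock_pair (fun x => - f x) (fun x => - g x).
Proof.
case=> cf cg sf sg; split.
- by move=> x; apply: cvgN; exact: cf.
- by move=> x; apply: cvgN; exact: cg.
- have := stieltjesN sf; congr (stieltjes _ _ _ _ _ _).
  by apply/funext => x; rewrite mulNr.
- have := stieltjesN sg; congr (stieltjes _ _ _ _ _ _).
  by apply/funext => x; rewrite mulNr.
Qed.

Lemma lm_within : {within `[a, b], continuous (fun x => - lm x)}.
Proof. by move=> x; apply: cvgN; exact: lm_cont. Qed.

Lemma Nlm_nondec :
  {in `[a, b] &, forall x y, (x <= y)%E -> - lm x <= - lm y}.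
Proof. by move=> x y xab yab xy; rewrite lerN2 lm_noninc. Qed.

Let osmall_lp t phi : t \in `[a, b] -> osmall a b lp t phi ->
  osmall a b (fun x => lp x - lm x) t phi.
Proof.
move=> tab /(@osmall_le _ _ _ _ (fun x => lp x - lm x)); apply=> y yab.
have [ty|/ltW yt] := leP t y.
  have := lp_nondec tab yab ty; have := lm_noninc tab yab ty => h1 h2.
  by rewrite !ger0_norm; lra.
have := lp_nondec yab tab yt; have := lm_noninc yab tab yt => h1 h2.
by rewrite !ler0_norm; lra.
Qed.

Let osmall_lm t phi : t \in `[a, b] -> osmall a b (fun x => - lm x) t phi ->
  osmall a b (fun x => lp x - lm x) t phi.
Proof.
move=> tab /(@osmall_le _ _ _ _ (fun x => lp x - lm x)); apply=> y yab.
have [ty|/ltW yt] := leP t y.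
  have := lp_nondec tab yab ty; have := lm_noninc tab yab ty => h1 h2.
  by rewrite !ger0_norm; lra.
have := lp_nondec yab tab yt; have := lm_noninc yab tab yt => h1 h2.
by rewrite !ler0_norm; lra.
Qed.

(** In the product rule [lp df] cancels [g dlm], and [lm dg] cancels [f dlp]. *)
Lemma luckock_pair_constant f g : luckock_pair f g ->
  {in `[a, b] &, forall x y, f x * lp x + g x * lm x = f y * lp y + g y * lm y}.
Proof.
case=> cf cg sf sg.
apply: (osmall_constant (V := fun x => lp x - lm x)
  (h := fun x => f x * lp x + g x * lm x)).
  by move=> x y xab yab xy; rewrite lerB ?lp_nondec ?lm_noninc.
move=> t tab.
have lpt := lp_itv_gt0 tab; have lmt := lm_itv_gt0 tab.
have lp0 : {in `[a, b], forall x, lp x != 0}.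
  by move=> x xab; rewrite gt_eqF ?lp_itv_gt0.
have lm0 : {in `[a, b], forall x, lm x != 0}.
  by move=> x xab; rewrite gt_eqF ?lm_itv_gt0.
have /(osmall_lm tab) o1 :=
  stieltjes_osmall (within_div cg lp_cont lp0) Nlm_nondec sf tab.
have /(osmall_lp tab) o2 :=
  stieltjes_osmall (within_div cf lm_cont lm0) lp_nondec sg tab.
have /(osmall_lp tab) o3 := osmall_increments lp cf tab.
have /(osmall_lm tab) o4 := osmall_increments (fun x => - lm x) cg tab.
apply: osmall_ext (osmallD (osmallD (osmallZ (lp t) o1) (osmallZ (- lm t) o2))
  (osmallD o3 (osmallZ (-1) o4))) => y yab /=.
by field; rewrite lm0 ?lp0.
Qed.

(** By the quotient rule [d(f / lm) = - (f lp + g lm) / (lp lm^2) dlm], and [dlm] is nonpositive. *)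
Lemma luckock_pair_nonincreasing f g : luckock_pair f g ->
  {in `[a, b], forall x, f x * lp x + g x * lm x <= 0} ->
  {in `[a, b] &, forall x y, (x <= y)%E -> f y / lm y <= f x / lm x}.
Proof.
case=> cf cg sf sg K0.
have lp0 : {in `[a, b], forall x, lp x != 0}.
  by move=> x xab; rewrite gt_eqF ?lp_itv_gt0.
have lm0 : {in `[a, b], forall x, lm x != 0}.
  by move=> x xab; rewrite gt_eqF ?lm_itv_gt0.
(* One factor [lm] is taken at [y] rather than at [t], so that the remainder is exactly that of [f]
   divided by [lm y]. *)
pose c t y := - (f t * lp t + g t * lm t) / (lp t * lm t * lm y).
have c0 t y : t \in `[a, b] -> y \in `[a, b] -> 0 <= c t y.
  move=> tab yab; rewrite divr_ge0 ?oppr_ge0 ?K0// !mulr_ge0// ltW//.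
  - exact: lp_itv_gt0.
  - exact: lm_itv_gt0.
  - exact: lm_itv_gt0.
apply: (osmall_nonincreasing (h := fun x => f x / lm x)
  (D := fun t y => c t y * (lm y - lm t)) Nlm_nondec).
- move=> t tab.
  have o1 := stieltjes_osmall (within_div cg lp_cont lp0) Nlm_nondec sf tab.
  have bnd : \forall y \near t, y \in `[a, b] -> `|(lm y)^-1| <= (lm b)^-1.
    apply: nearW => y yab; have lmy := lm_itv_gt0 yab.
    by rewrite gtr0_norm ?invr_gt0// lef_pV2 ?posrE ?ge_lm_b.
  apply: osmall_ext (osmallM o1 bnd) => y yab /=.
  by rewrite /c; field; rewrite !lm0 ?lp0.
- by move=> t y tab yab ty; rewrite mulr_ge0_le0 ?c0// subr_le0 lm_noninc.
- by move=> t y tab yab yt; rewrite mulr_ge0 ?c0// subr_ge0 lm_noninc.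
Qed.

(** Since [g a = 0], the first integral equals [f a * lp a]. If [f a] were nonzero, [f / lm] would
    move away from 0 on the way to [b], against [f b = 0]. So the first integral is 0, and [f / lm]
    is both nonincreasing and nondecreasing. *)
Lemma luckock_pair_zero f g : luckock_pair f g -> f b = 0 -> g a = 0 ->
  {in `[a, b], forall x, f x = 0 /\ g x = 0}.
Proof.
move=> fg fb ga; have K := luckock_pair_constant fg.
have KN := luckock_pairN fg.
have aI := a_itv; have bI := b_itv.
have Ka x : x \in `[a, b] -> f x * lp x + g x * lm x = f a * lp a.
  by move=> xab; rewrite (K x a)// ga mul0r addr0.
have lma : 0 < lm a by rewrite lm_itv_gt0.
have fa0 : f a = 0.
  apply: le_anti; apply/andP; split; rewrite leNgt; apply/negP => fa.
    have /(_ _)/= h := luckock_pair_nonincreasing KN _ aI bI (ltW hab).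
    have : - f b / lm b <= - f a / lm a.
      apply: h => x xab; rewrite !mulNr -opprD oppr_le0 Ka//.
      by rewrite mulr_ge0// ltW.
    rewrite fb oppr0 mul0r; apply/negP; rewrite -ltNge.
    by rewrite pmulr_llt0 ?invr_gt0// oppr_lt0.
  have h := luckock_pair_nonincreasing fg _ aI bI (ltW hab).
  have : f b / lm b <= f a / lm a.
    by apply: h => x xab; rewrite Ka// mulr_le0_ge0// ltW.
  rewrite fb mul0r; apply/negP; rewrite -ltNge.
  by rewrite pmulr_llt0 ?invr_gt0.
have K0 x : x \in `[a, b] -> f x * lp x + g x * lm x = 0.
  by move=> xab; rewrite Ka// fa0 mul0r.
have f0 x : x \in `[a, b] -> f x = 0.
  move=> xab; have lmx := lm_itv_gt0 xab.
  have h : f x / lm x <= f a / lm a.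
    by apply: (luckock_pair_nonincreasing fg) => // [y yab|]; rewrite ?K0// (itvP xab).
  have hN : - f x / lm x <= - f a / lm a.
    apply: (luckock_pair_nonincreasing KN) => // [y yab|]; last by rewrite (itvP xab).
    by rewrite !mulNr -opprD K0// oppr0.
  move: h hN; rewrite fa0 oppr0 !mul0r pmulr_lle0 ?invr_gt0// => h.
  rewrite pmulr_lle0 ?invr_gt0// oppr_le0 => h'.
  by apply/le_anti/andP.
move=> x xab; split; first exact: f0.
have := K0 x xab; rewrite f0// mul0r add0r => /eqP; rewrite mulf_eq0.
by rewrite (gt_eqF (lm_itv_gt0 xab)) orbF => /eqP.
Qed.

(** A first integral that is not positive would make [f / lm] nonincreasing, hence [f a] positive;
    but then its value [f a * lp a + lm a] at [a] is positive. *)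
Lemma luckock_pair_pos f g : luckock_pair f g -> f b = 1 -> g a = 1 ->
  {in `[a, b], forall x, 0 < f x * lp x + g x * lm x}.
Proof.
move=> fg fb ga; have K := luckock_pair_constant fg.
have aI := a_itv; have bI := b_itv.
move=> x xab; rewrite ltNge; apply/negP => K0.
have /= h := luckock_pair_nonincreasing fg _ aI bI (ltW hab).
have {}h : f b / lm b <= f a / lm a by apply: h => y yab; rewrite (K y x).
have fa : 0 < f a / lm a by rewrite (lt_le_trans _ h)// fb divr_gt0.
move: K0; rewrite (K x a)// ga mul1r; apply/negP; rewrite -ltNge.
have lma : 0 < lm a by rewrite lm_itv_gt0.
rewrite ltr_wpDl// mulr_ge0 ?(ltW lp_gt0)//.
by move: fa; rewrite pmulr_lgt0 ?invr_gt0// => /ltW.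
Qed.

End luckock_pairs.

(** * Measurability of one-sided continuous functions *)

Section one_sided_measurability.
Context (R : realType).
Implicit Types (S : set (\bar R)) (a b x y u : \bar R) (w : \bar R -> R).

(** Such a set need not be open, but it is still a countable union of intervals, one for each
    rational [q]: the points reached from [q] without leaving the set. The point [-oo], which has
    nothing to its left, is split off. *)
Lemma measurable_left_open S :
  (forall x, S x -> x != -oo%E ->
    exists2 y, (y < x)%E & forall u, (y < u <= x)%E -> S u) ->
  measurable S.
Proof.
move=> openS.
pose I (q : rat) := [set x | ((ratr q)%:E <= x)%E /\
  forall u, ((ratr q)%:E <= u <= x)%E -> S u].
have -> : S = (S `&` [set -oo%E]) `|` \bigcup_q I q.
  apply/seteqP; split => [x Sx|x [[]//|[q _ [qx]]]]; last first.
    by apply; rewrite qx lexx.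
  have [xE|xNy] := eqVneq x -oo%E; first by left.
  have [y yx yS] := openS x Sx xNy.
  have [q /andP[yq qx]] := ereal_rat_between yx.
  right; exists q => //; split; first exact: ltW.
  by move=> u /andP[qu ux]; apply: yS; rewrite ux (lt_le_trans yq qu).
apply: measurableU.
  have [/set0P[x [Sx xNy]]|/negPn/eqP ->//] := boolP (S `&` [set -oo%E] != set0).
  suff -> : S `&` [set -oo%E] = [set -oo%E] by exact: emeasurable_set1.
  by apply/seteqP; split => [y []//|y ->]; split => //; rewrite -xNy.
apply: bigcupT_measurable_rat => q.
(* [I q] contains everything between [q] and any of its points, so it is an interval, closed or open
   on the right according to whether it contains its supremum. *)
pose s := ereal_sup (I q).
have Idown x y : I q y -> ((ratr q)%:E <= x)%E -> (x <= y)%E -> I q x.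
  move=> [qy Iy] qx xy; split => // u /andP[qu ux]; apply: Iy.
  by rewrite qu (le_trans ux xy).
have [Is|Is] := pselect (I q s).
  suff -> : I q = `[(ratr q)%:E, s]%classic by exact: emeasurable_itv.
  apply/seteqP; split => [x Ix|x]; rewrite /= in_itv/=.
    by rewrite (ereal_sup_ubound Ix) andbT; case: Ix.
  by move=> /andP[qx xs]; exact: Idown xs.
suff -> : I q = `[(ratr q)%:E, s[%classic by exact: emeasurable_itv.
apply/seteqP; split => [x Ix|x]; rewrite /= in_itv/=.
  rewrite lt_neqAle (ereal_sup_ubound Ix) andbT; apply/andP; split; first by case: Ix.
  by apply/eqP => xs; apply: Is; rewrite -xs.
move=> /andP[qx xs].
have [y Iy xy] : exists2 y, I q y & (x < y)%E.
  apply: contrapT => nex; move: xs; rewrite ltNge => /negP; apply.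
  apply: ge_ereal_sup => y Iy; rewrite leNgt; apply/negP => xy.
  by apply: nex; exists y.
exact: Idown (ltW xy).
Qed.

Lemma measurable_right_open S :
  (forall x, S x -> x != +oo%E ->
    exists2 y, (x < y)%E & forall u, (x <= u < y)%E -> S u) ->
  measurable S.
Proof.
move=> openS; have -> : S = -%E @^-1` (-%E @^-1` S).
  by apply/funext => x; rewrite /preimage/= oppeK.
rewrite -[X in measurable X]setTI; apply: oppe_measurable => //.
apply: measurable_left_open => x /= Sx xNy.
have [|y xy yS] := openS _ Sx; first by rewrite eqe_oppLR.
exists (- y)%E; first by rewrite lteNl.
by move=> u /andP[yu ux]; apply: yS; rewrite leeN2 ux lteNl.
Qed.

Lemma nbhs_left_itv x (P : set (\bar R)) : nbhs x P -> x != -oo%E ->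
  exists2 y, (y < x)%E & forall u, (y < u <= x)%E -> P u.
Proof.
move=> /nbhs_convex/nbhs_left_exists /[swap] xNy.
have Nyx : (-oo < x)%E by rewrite ltNye.
move=> /(_ _ Nyx)[y [_ yx yP]]; exists y => // u /andP[yu ux].
by apply: yP; right; rewrite ux ltW.
Qed.

Lemma nbhs_right_itv x (P : set (\bar R)) : nbhs x P -> x != +oo%E ->
  exists2 y, (x < y)%E & forall u, (x <= u < y)%E -> P u.
Proof.
move=> /nbhs_convex/nbhs_right_exists /[swap] xNy.
have xy : (x < +oo)%E by rewrite ltey.
move=> /(_ _ xy)[y [xy' _ yP]]; exists y => // u /andP[xu uy].
by apply: yP; left; rewrite xu ltW.
Qed.

Lemma left_continuous_measurable a b w :
  (forall x, x \in `]a, b] -> w @ within [set y | (y < x)%E] (nbhs x) --> w x) ->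
  measurable_fun `[a, b] w.
Proof.
move=> lw; apply: (measurability _ (RGenOInfty.measurableE R)).
move=> _ [_ [r ->] <-].
set B := `]r, +oo[%classic.
(* Left-continuity says nothing at [a], so this point is treated apart. *)
have -> : `[a, b]%classic `&` w @^-1` B =
    (`[a, b]%classic `&` w @^-1` B `&` [set a]) `|` (`]a, b]%classic `&` w @^-1` B).
  apply/seteqP; split => [x [/= xab Bx]|x [[//]|[/= xab Bx]]]; last first.
    by split => //=; move: xab; rewrite !in_itv/= => /andP[/ltW -> ->].
  have [xa|xa] := eqVneq x a; first by left.
  by right; split => //=; rewrite in_itv/= lt_neqAle eq_sym xa !(itvP xab).
apply: measurableU.
  set C := _ `&` [set a].
  have [/set0P[x [Bx /= xa]]|/negPn/eqP ->//] := boolP (C != set0).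
  suff -> : C = [set a] by exact: emeasurable_set1.
  by rewrite xa in Bx; apply/seteqP; split => [y []//|y ->].
apply: measurable_left_open => x [/= xab Bx] xNy.
have wB : nbhs (w x) B by apply: open_nbhs_nbhs; split => //; exact: rray_open.
have nB : nbhs x [set y | (y < x)%E -> B (w y)] := lw x xab B wB.
have na : nbhs x [set y | (a < y)%E].
  apply: open_nbhs_nbhs; split; first exact: open_ereal_gt_ereal.
  by rewrite /= (itvP xab).
have [y yx yP] := nbhs_left_itv (filterI nB na) xNy.
exists y => // u yux; have [/= uB au] := yP u yux.
case/andP: yux => yu; rewrite le_eqVlt => /predU1P[->//|ux].
split; last exact: uB.
by rewrite /= in_itv/= au (le_trans (ltW ux))// (itvP xab).
Qed.

Lemma right_continuous_measurable a b w :
  (forall x, x \in `[a, b[ -> w @ within [set y | (x < y)%E] (nbhs x) --> w x) ->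
  measurable_fun `[a, b] w.
Proof.
move=> rw; apply: (measurability _ (RGenOInfty.measurableE R)).
move=> _ [_ [r ->] <-].
set B := `]r, +oo[%classic.
have -> : `[a, b]%classic `&` w @^-1` B =
    (`[a, b]%classic `&` w @^-1` B `&` [set b]) `|` (`[a, b[%classic `&` w @^-1` B).
  apply/seteqP; split => [x [/= xab Bx]|x [[//]|[/= xab Bx]]]; last first.
    by split => //=; move: xab; rewrite !in_itv/= => /andP[-> /ltW ->].
  have [xb|xb] := eqVneq x b; first by left.
  by right; split => //=; rewrite in_itv/= lt_neqAle xb !(itvP xab).
apply: measurableU.
  set C := _ `&` [set b].
  have [/set0P[x [Bx /= xb]]|/negPn/eqP ->//] := boolP (C != set0).
  suff -> : C = [set b] by exact: emeasurable_set1.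
  by rewrite xb in Bx; apply/seteqP; split => [y []//|y ->].
apply: measurable_right_open => x [/= xab Bx] xNy.
have wB : nbhs (w x) B by apply: open_nbhs_nbhs; split => //; exact: rray_open.
have nB : nbhs x [set y | (x < y)%E -> B (w y)] := rw x xab B wB.
have na : nbhs x [set y | (y < b)%E].
  apply: open_nbhs_nbhs; split; first exact: open_ereal_lt_ereal.
  by rewrite /= (itvP xab).
have [y yx yP] := nbhs_right_itv (filterI nB na) xNy.
exists y => // u yux; have [/= uB ub] := yP u yux.
case/andP: yux; rewrite le_eqVlt => /predU1P[<-//|xu] uy.
split; last exact: uB.
by rewrite /= in_itv/= ub (le_trans _ (ltW xu))// (itvP xab).
Qed.

Lemma within_left_continuous a b w : {within `[a, b], continuous w} ->
  forall x, x \in `]a, b] -> w @ within [set y | (y < x)%E] (nbhs x) --> w x.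
Proof.
move=> /subspace_continuousP cw x xab.
have /cw h : (`[a, b]%classic : set _) x.
  by move: xab; rewrite /= !in_itv/= => /andP[/ltW -> ->].
apply: cvg_trans h => U hU.
have {}hU : nbhs x [set y | `[a, b]%classic y -> U (w y)] := hU.
suff : nbhs x [set y | (y < x)%E -> U (w y)] by [].
have na : nbhs x [set y | (a < y)%E].
  apply: open_nbhs_nbhs; split; first exact: open_ereal_gt_ereal.
  by rewrite /= (itvP xab).
apply: filterS2 hU na => y yU ay yx; apply: yU.
by rewrite /= in_itv/= (ltW ay) (le_trans (ltW yx))// (itvP xab).
Qed.

Lemma within_right_continuous a b w : {within `[a, b], continuous w} ->
  forall x, x \in `[a, b[ -> w @ within [set y | (x < y)%E] (nbhs x) --> w x.
Proof.
move=> /subspace_continuousP cw x xab.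
have /cw h : (`[a, b]%classic : set _) x.
  by move: xab; rewrite /= !in_itv/= => /andP[-> /ltW ->].
apply: cvg_trans h => U hU.
have {}hU : nbhs x [set y | `[a, b]%classic y -> U (w y)] := hU.
suff : nbhs x [set y | (x < y)%E -> U (w y)] by [].
have na : nbhs x [set y | (y < b)%E].
  apply: open_nbhs_nbhs; split; first exact: open_ereal_lt_ereal.
  by rewrite /= (itvP xab).
apply: filterS2 hU na => y yU yb xy; apply: yU.
by rewrite /= in_itv/= (ltW yb) (le_trans _ (ltW xy))// (itvP xab).
Qed.

End one_sided_measurability.

(** * Integrals over intervals *)

#[local] Hint Extern 0 (measurable [set` _]) => exact: emeasurable_itv : core.
#[local] Hint Extern 0 (measurable [set _]) => exact: emeasurable_set1 : core.

Lemma bounded_on (T : Type) (R : realType) (A : set T) (f : T -> R) (M : R) :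
  (forall x, A x -> `|f x| <= M) -> [bounded f x | x in A].
Proof.
move=> fM; exists M; split; first exact: num_real.
by move=> N MN x Ax; exact: le_trans (fM x Ax) (ltW MN).
Qed.

Lemma Rintegral_near_constant d (T : measurableType d) (R : realType)
    (m : {measure set T -> \bar R}) (A : set T) (w : T -> R) (k e : R) :
  measurable A -> (m A < +oo)%E -> m.-integrable A (EFin \o w) ->
  (forall x, A x -> `|w x - k| <= e) ->
  `|\int[m]_(x in A) w x - k * fine (m A)| <= e * fine (m A).
Proof.
move=> mA mAoo iw wk.
have ic (c : R) : m.-integrable A (EFin \o cst c).
  apply: measurable_bounded_integrable => //.
  exact: (@bounded_on _ _ _ _ `|c|).
have iwk : m.-integrable A (EFin \o (fun x => w x - k)).
  exact: (integrableB mA iw (ic k)).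
rewrite -[k * _]Rintegral_cst// -RintegralB//; last exact: ic.
apply: (le_trans (le_normr_Rintegral mA iwk)).
rewrite -Rintegral_cst//; apply: le_Rintegral => //; last exact: ic.
exact: integrable_norm.
Qed.

Section interval_integrals.
Context (R : realType) (a b : \bar R).
Variable m : {finite_measure set (\bar R) -> \bar R}.
Variable L : \bar R -> R.
Hypothesis (hab : (a < b)%E).
Hypothesis mL : {in `[a, b] &, forall x y, (x < y)%E ->
  m `]x, y[%classic = (L y - L x)%:E}.
Implicit Types (x y t : \bar R) (w : \bar R -> R).

Local Notation P w x y := (\int[m]_(u in `]x, y[) w u).

Lemma itv_measureE : {in `[a, b] &, forall x y, (x <= y)%E ->
  fine (m `]x, y[%classic) = L y - L x}.
Proof.
move=> x y xab yab; rewrite le_eqVlt => /predU1P[->|xy]; last by rewrite mL.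
by rewrite set_itv_ge ?bnd_simp ?ltxx// measure0 subrr.
Qed.

Lemma itv_subset x y : x \in `[a, b] -> y \in `[a, b] ->
  `]x, y[%classic `<=` `[a, b]%classic.
Proof.
move=> xab yab u /=; rewrite !in_itv/= => /andP[xu uy].
by rewrite (le_trans _ (ltW xu)) ?(le_trans (ltW uy))// (itvP xab, itvP yab).
Qed.

(** Additivity over the two open intervals beside [t] leaves no mass for [t]. The endpoints are
    excluded because the order measures do have atoms there. *)
Lemma itv_atomless t : t \in `]a, b[ -> m [set t] = 0%E.
Proof.
rewrite in_itv/= => /andP[at_ tb].
have tab : t \in `[a, b] by rewrite in_itv/= !ltW.
have aI : a \in `[a, b] by rewrite in_itv/= lexx ltW.
have bI : b \in `[a, b] by rewrite in_itv/= lexx ltW.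
have E : `]a, b[%classic = `]a, t[%classic `|` ([set t] `|` `]t, b[%classic).
  apply/seteqP; split => u /=; rewrite !in_itv/=.
    by move=> /andP[au ub]; case: (ltgtP u t) => ut;
      [left; rewrite au|right; right; rewrite ub|right; left].
  by move=> [/andP[-> /lt_trans->//]|[->|/andP[/(lt_trans at_)-> ->//]]];
    rewrite ?at_.
have mt : measurable [set t] by exact: emeasurable_set1.
have mI (i : interval (\bar R)) : measurable [set` i] by exact: emeasurable_itv.
have mU : measurable ([set t] `|` `]t, b[%classic) by exact: measurableU.
have dl : `]a, t[%classic `&` ([set t] `|` `]t, b[%classic) = set0.
  apply/seteqP; split => // u /= [].
  rewrite !in_itv/= => /andP[_ ut] [ut'|/andP[tu _]].
    by rewrite ut' ltxx in ut.
  by have := lt_trans ut tu; rewrite ltxx.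
have dr : [set t] `&` `]t, b[%classic = set0.
  by apply/seteqP; split => // u /= [->]; rewrite in_itv/= ltxx.
have mE : m `]a, b[%classic =
    (m `]a, t[%classic + (m [set t] + m `]t, b[%classic))%E.
  by rewrite E measureU// measureU.
move: mE; rewrite !mL//.
have : m [set t] \is a fin_num by rewrite fin_num_measure.
case: (m [set t]) => // r _ [h]; congr (_%:E); lra.
Qed.

Lemma itv_integrable w x y : m.-integrable `[a, b] (EFin \o w) ->
  x \in `[a, b] -> y \in `[a, b] -> m.-integrable `]x, y[ (EFin \o w).
Proof. by move=> iw xab yab; apply: integrableS iw => //; exact: itv_subset. Qed.

Lemma itv_integral_split w x t y : m.-integrable `[a, b] (EFin \o w) ->
  x \in `[a, b] -> t \in `[a, b] -> y \in `[a, b] -> (x <= t <= y)%E ->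
  P w x y = P w x t + P w t y.
Proof.
move=> iw xab tab yab /andP[].
rewrite le_eqVlt => /predU1P[<- _|xt].
  by rewrite [X in _ = \int[_]_(_ in X) _ + _]set_itv_ge ?bnd_simp ?ltxx//
    Rintegral_set0 add0r.
rewrite le_eqVlt => /predU1P[<-|ty].
  by rewrite [X in _ = _ + \int[_]_(_ in X) _]set_itv_ge ?bnd_simp ?ltxx//
    Rintegral_set0 addr0.
have E : `]x, y[%classic = `]x, t[%classic `|` ([set t] `|` `]t, y[%classic).
  apply/seteqP; split => u /=; rewrite !in_itv/=.
    by move=> /andP[au ub]; case: (ltgtP u t) => ut;
      [left; rewrite au|right; right; rewrite ub|right; left].
  by move=> [/andP[-> /lt_trans->//]|[->|/andP[/(lt_trans xt)-> ->//]]];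
    rewrite ?xt.
have iE := itv_integrable iw xab yab.
have it : m.-integrable [set t] (EFin \o w).
  by apply: integrableS iw => // u /= ->.
have mt : measurable [set t] by exact: emeasurable_set1.
have mI (i : interval (\bar R)) : measurable [set` i] by exact: emeasurable_itv.
have mU : measurable ([set t] `|` `]t, y[%classic) by exact: measurableU.
have dl : [disjoint `]x, t[%classic & [set t] `|` `]t, y[%classic].
  apply/disj_set2P/seteqP; split => // u /= [].
  rewrite !in_itv/= => /andP[_ ut] [ut'|/andP[tu _]].
    by rewrite ut' ltxx in ut.
  by have := lt_trans ut tu; rewrite ltxx.
have dr : [disjoint [set t] & `]t, y[%classic].
  by apply/disj_set2P/seteqP; split => // u /= [->]; rewrite in_itv/= ltxx.
rewrite E in iE; rewrite {1}E Rintegral_setU//.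
congr (_ + _); rewrite Rintegral_setU//; last first.
  by apply: integrableS iE; [exact: measurableU|exact: mU|move=> u; right].
rewrite [X in X + _](_ : _ = 0) ?add0r//.
rewrite /Rintegral null_set_integral//; first exact: (measurable_int m).
apply: itv_atomless; rewrite in_itv/= (le_lt_trans _ xt) ?(lt_le_trans ty)//.
  by rewrite (itvP yab).
by rewrite (itvP xab).
Qed.

Lemma itv_integral_near w x y (k e : R) : m.-integrable `[a, b] (EFin \o w) ->
  x \in `[a, b] -> y \in `[a, b] -> (x <= y)%E ->
  (forall u, (x < u < y)%E -> `|w u - k| <= e) ->
  `|P w x y - k * (L y - L x)| <= e * (L y - L x).
Proof.
move=> iw xab yab xy wk; rewrite -itv_measureE//.
apply: Rintegral_near_constant => //.
- by rewrite ltey_eq fin_num_measure.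
- exact: itv_integrable.
Qed.

(** Passing from [w] to [w'] lets a one-sidedly continuous density be replaced by a continuous one
    that may differ from it at the endpoints. *)
Lemma itv_integral_stieltjesl w w' : m.-integrable `[a, b] (EFin \o w) ->
  {in `]a, b[, w =1 w'} -> stieltjes a b w' L L (fun y => P w a y).
Proof.
move=> iw ww' x y xab yab xy k e wk.
have aI : a \in `[a, b] by rewrite in_itv/= lexx ltW.
have -> : P w a y = P w a x + P w x y.
  by apply: itv_integral_split => //; rewrite xy (itvP xab).
have -> : P w a x + P w x y - P w a x = P w x y by ring.
apply: itv_integral_near => // u /andP[xu uy]; rewrite ww' ?wk ?ltW//.
by rewrite in_itv/= (le_lt_trans _ xu) ?(lt_le_trans uy)// ?(itvP xab) ?(itvP yab).
Qed.

Lemma itv_integral_stieltjesr w w' : m.-integrable `[a, b] (EFin \o w) ->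
  {in `]a, b[, w =1 w'} -> stieltjes a b w' L L (fun x => - P w x b).
Proof.
move=> iw ww' x y xab yab xy k e wk.
have bI : b \in `[a, b] by rewrite in_itv/= lexx ltW.
have -> : P w x b = P w x y + P w y b.
  by apply: itv_integral_split => //; rewrite xy (itvP yab).
have -> : - P w y b - - (P w x y + P w y b) = P w x y by ring.
apply: itv_integral_near => // u /andP[xu uy]; rewrite ww' ?wk ?ltW//.
by rewrite in_itv/= (le_lt_trans _ xu) ?(lt_le_trans uy)// ?(itvP xab) ?(itvP yab).
Qed.

End interval_integrals.

(** * Integrals against the differential of a function of bounded variation *)

Section charge_integrals.
Context (R : realType) (a b : \bar R) (f : \bar R -> R).
Variable nu : {charge set (\bar R) -> \bar R}.
Hypothesis nuf : is_differential a b f nu.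
Implicit Types (x y : \bar R) (w : \bar R -> R).

Lemma charge_pos_fin_num A : measurable A -> charge_pos nu A \is a fin_num.
Proof. by move=> mA; rewrite /charge_pos fin_num_measure. Qed.

Lemma charge_neg_fin_num A : measurable A -> charge_neg nu A \is a fin_num.
Proof. by move=> mA; rewrite /charge_neg fin_num_measure. Qed.

Lemma charge_jordanE A : measurable A ->
  nu A = (charge_pos nu A - charge_neg nu A)%E.
Proof.
move=> mA; rewrite /charge_pos /charge_neg.
have := jordan_decomp (projT2 (cid (projT2 (cid (Hahn_decomposition nu))))) mA.
by rewrite /cadd/= cscaleN1.
Qed.

(** The distribution function of the total variation measure of [nu]; it is the dominating monotone
    function when the integrator itself is not monotone. *)
Definition variation_from x : R :=
  fine (charge_pos nu `]a, x]%classic) + fine (charge_neg nu `]a, x]%classic).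

Let itv_split x y : (a <= x)%E -> (x <= y)%E ->
  `]a, y]%classic = `]a, x]%classic `|` `]x, y]%classic.
Proof.
move=> ax xy; apply/seteqP; split => u /=; rewrite !in_itv/=.
  by move=> /andP[au uy]; case: (leP u x) => ux; [left; rewrite au|right; rewrite uy].
by move=> [/andP[-> /le_trans->//]|/andP[/(le_lt_trans ax)-> ->//]].
Qed.

Let itv_disj x y : `]a, x]%classic `&` `]x, y]%classic = set0.
Proof.
apply/seteqP; split => // u /=; rewrite !in_itv/= => -[/andP[_ ux] /andP[xu _]].
by have := lt_le_trans xu ux; rewrite ltxx.
Qed.

Lemma variation_from_increment x y : (a <= x)%E -> (x <= y)%E ->
  variation_from y - variation_from x =
  fine (charge_pos nu `]x, y]%classic) + fine (charge_neg nu `]x, y]%classic).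
Proof.
move=> ax xy; rewrite /variation_from (itv_split ax xy) !measureU//.
rewrite !fineD ?charge_pos_fin_num ?charge_neg_fin_num//; ring.
Qed.

Lemma variation_from_nondecreasing :
  {in `[a, b] &, forall x y, (x <= y)%E ->
    variation_from x <= variation_from y}.
Proof.
move=> x y xab yab xy.
by rewrite -subr_ge0 variation_from_increment ?(itvP xab)// addr_ge0 ?fine_ge0.
Qed.

Lemma charge_integral_stieltjes w :
  (charge_pos nu).-integrable `[a, b] (EFin \o w) ->
  (charge_neg nu).-integrable `[a, b] (EFin \o w) ->
  stieltjes a b w f variation_from (fun x => charge_integral nu `]a, x]%classic w).
Proof.
move=> ip ineg x y xab yab xy k e wk.
have [_ _ /(_ x y xab yab xy)] := nuf.
rewrite charge_jordanE// => nuxy.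
have sub u v : (a <= u)%E -> v \in `[a, b] -> `]u, v]%classic `<=` `[a, b]%classic.
  move=> au vab z /=; rewrite !in_itv/= => /andP[uz zv].
  by rewrite (le_trans au (ltW uz)) (le_trans zv)// (itvP vab).
have ax : (a <= x)%E by rewrite (itvP xab).
have fE : f y - f x = fine (charge_pos nu `]x, y]%classic) -
    fine (charge_neg nu `]x, y]%classic).
  have h1 : charge_pos nu `]x, y]%classic \is a fin_num by exact: charge_pos_fin_num.
  have h2 : charge_neg nu `]x, y]%classic \is a fin_num by exact: charge_neg_fin_num.
  by rewrite -fineB// nuxy.
rewrite variation_from_increment// fE /charge_integral (itv_split ax xy).
have dj : [disjoint `]a, x]%classic & `]x, y]%classic] by apply/disj_set2P/itv_disj.
have mU : measurable (`]a, x]%classic `|` `]x, y]%classic) by exact: measurableU.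
have sU : `]a, x]%classic `|` `]x, y]%classic `<=` `[a, b]%classic.
  by rewrite -(itv_split ax xy); apply: sub.
rewrite !Rintegral_setU//; try by apply: integrableS sU _.
have wk' u : `]x, y]%classic u -> `|w u - k| <= e.
  by rewrite /= in_itv/= => /andP[/ltW xu uy]; rewrite wk ?xu.
have hp := @Rintegral_near_constant _ _ _ (charge_pos nu) `]x, y]%classic w k e.
have hn := @Rintegral_near_constant _ _ _ (charge_neg nu) `]x, y]%classic w k e.
have {}hp := hp _ _ _ wk'; have {}hn := hn _ _ _ wk'.
set p1 := Rintegral _ _ _; set p2 := Rintegral _ `]x, y]%classic _ in hp *.
set n1 := Rintegral _ _ _; set n2 := Rintegral _ `]x, y]%classic _ in hn *.
set p := fine _ in hp *; set n := fine _ in hn *.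
have -> : p1 + p2 - (n1 + n2) - (p1 - n1) - k * (p - n) =
  (p2 - k * p) - (n2 - k * n) by ring.
rewrite (le_trans (ler_normB _ _))// mulrDr lerD//.
- by apply: hp => //; [rewrite ltey_eq charge_pos_fin_num|
    apply: integrableS ip => //; exact: sub].
- by apply: hn => //; [rewrite ltey_eq charge_neg_fin_num|
    apply: integrableS ineg => //; exact: sub].
Qed.

End charge_integrals.

(** * Configurations and Luckock maps *)

(** This exposes the choice hidden in the Jordan parts: both come from one and the same Hahn
    decomposition. *)
Lemma charge_parts_hahn d (T : measurableType d) (R : realType)
    (nu : {charge set T -> \bar R}) :
  exists P N, hahn_decomposition nu P N /\ forall A, measurable A ->
    charge_pos nu A = nu (A `&` P) /\ charge_neg nu A = (- nu (A `&` N))%E.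
Proof.
have [P [N [h hE]]] : exists P N (h : hahn_decomposition nu P N),
    charge_pos nu = jordan_pos h /\ charge_neg nu = jordan_neg h.
  exists (projT1 (cid (Hahn_decomposition nu))).
  exists (projT1 (cid (projT2 (cid (Hahn_decomposition nu))))).
  by exists (projT2 (cid (projT2 (cid (Hahn_decomposition nu))))).
exists P, N; split => // A mA; have [-> ->] := hE.
split.
  have := jordan_posE h A.
  by rewrite cjordan_posE /crestr0 mem_set.
have := jordan_negE h A.
by rewrite cjordan_negE /crestr0 mem_set.
Qed.

Section finite_sums_of_deltas.
Context (R : realType).
Implicit Types (s : seq (\bar R)) (x y : \bar R) (A : set (\bar R)).

Lemma deltasE s A : deltas s A = (\sum_(x <- s) (x \in A)%:R)%:E.
Proof.
rewrite -sumEFin /deltas /= /msum (big_nth 0%E) big_mkord.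
by apply: eq_bigr => i _; rewrite /= diracE.
Qed.

Lemma deltas_cons x s A : deltas (x :: s) A = (\d_x A + deltas s A)%E.
Proof. by rewrite !deltasE big_cons EFinD diracE. Qed.

Lemma deltas_rem x s A : x \in s -> deltas s A = (\d_x A + deltas (rem x s) A)%E.
Proof.
move=> xs; rewrite !deltasE diracE -EFinD; congr (_%:E).
by rewrite (perm_big _ (perm_to_rem xs)) big_cons.
Qed.

Lemma deltas_set1_gt0 s x : (0 < deltas s [set x])%E = (x \in s).
Proof.
rewrite deltasE lte_fin; elim: s => [|y s IH]; first by rewrite big_nil ltxx.
rewrite big_cons !inE in_set1 eq_sym.
have s0 : 0 <= \sum_(z <- s) (z \in [set x])%:R :> R by rewrite sumr_ge0.
by have [xy|xy] := eqVneq x y; rewrite /= ?add0r ?ltr_wpDr.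
Qed.

Lemma deltas_set1_eq0 s x : x \notin s -> deltas s [set x] = 0%E.
Proof.
move=> xs; apply/eqP; rewrite eq_le measure_ge0 andbT leNgt.
by rewrite deltas_set1_gt0.
Qed.

Lemma integral_deltas (D : set (\bar R)) s (w : \bar R -> R) :
  measurable D -> measurable_fun D w -> (forall x, x \in s -> D x) ->
  \int[deltas s]_(x in D) w x = \sum_(x <- s) w x.
Proof.
move=> mD mw sD; rewrite /Rintegral.
have mwE : measurable_fun D (EFin \o w) by exact/measurable_EFinP.
have part (g : \bar R -> \bar R) : (forall x, (0 <= g x)%E) -> measurable_fun D g ->
    (\int[deltas s]_(x in D) g x = \sum_(x <- s) g x)%E.
  move=> g0 mg; rewrite ge0_integral_measure_sum// (big_nth 0%E) big_mkord.
  apply: eq_bigr => i _; rewrite integral_dirac// diracE mem_set ?mul1e//.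
  by apply: sD; rewrite mem_nth.
rewrite integralE !part//; [|exact: measurable_funeneg|exact: measurable_funepos].
rewrite -[fun x => (w x)%:E]/(EFin \o w) funerpos funerneg !sumEFin/= -sumrB.
by apply: eq_bigr => x _; rewrite -[in RHS](funrposBneg w).
Qed.

End finite_sums_of_deltas.

Section signed_point_configurations.
Context (R : realType) (a b : \bar R).
Implicit Types (sp sm : seq (\bar R)) (x y u : \bar R) (A : set (\bar R)).
Implicit Types (X : {charge set (\bar R) -> \bar R}) (wm wp : \bar R -> R).

(** The lists carry multiplicities. The order condition says that negative atoms lie strictly to the
    left of positive ones, so that no point is in both lists. *)
Definition represents sp sm X :=
  [/\ {subset sp <= `]a, b[}, {subset sm <= `]a, b[},
      {in sm & sp, forall y x, (y < x)%E}
    & forall A, measurable A -> X A = (deltas sp A - deltas sm A)%E].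

Lemma Sord_finP X : Sord_fin a b X <-> exists sp sm, represents sp sm X.
Proof.
split=> [[sp [sm [[psub msub] ord XE]]]|[sp [sm [psub msub ord XE]]]];
  exists sp, sm; split=> //.
- move=> y x ym xp; rewrite ltNge; apply/negP => xy.
  apply: (ord x y) => //; [exact: psub|exact: msub|].
  by rewrite !deltas_set1_gt0.
- move=> x y _ _ xy; rewrite !deltas_set1_gt0 => -[xp ym].
  by have := ord y x ym xp; rewrite ltNge xy.
Qed.

Section one_configuration.
Variables (sp sm : seq (\bar R)) (X : {charge set (\bar R) -> \bar R}).
Hypothesis rX : represents sp sm X.

Let disj x : x \in sp -> x \in sm -> False.
Proof. by case: rX => _ _ ord _ xp xm; have := ord x x xm xp; rewrite ltxx. Qed.

Lemma represents_pos x : (0 < X [set x])%E = (x \in sp).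
Proof.
have [_ _ _ ->//] := rX.
have [xp|xp] := boolP (x \in sp).
  rewrite [X in (_ - X)%E]deltas_set1_eq0 ?sube0 ?deltas_set1_gt0//.
  by apply/negP => /(disj xp).
rewrite deltas_set1_eq0// sub0e oppe_gt0.
by apply/negbTE; rewrite -leNgt.
Qed.

Lemma represents_neg x : (X [set x] < 0)%E = (x \in sm).
Proof.
have [_ _ _ ->//] := rX.
have [xm|xm] := boolP (x \in sm).
  rewrite [X in (X - _)%E]deltas_set1_eq0 ?sub0e ?oppe_lt0 ?deltas_set1_gt0//.
  by apply/negP => /disj /(_ xm).
rewrite [X in (_ - X)%E]deltas_set1_eq0// sube0.
by apply/negbTE; rewrite -leNgt.
Qed.

(** A point of positive mass cannot lie in a negative set, nor one of negative mass in a positive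
    set; so whichever Hahn decomposition was chosen separates the two lists. *)
Let hahn P N (h : hahn_decomposition X P N) :
  (forall x, x \in sp -> P x /\ ~ N x) /\ (forall x, x \in sm -> N x /\ ~ P x).
Proof.
have [[mP posP] [mN negN] PN PN0] := h.
have cov x : P x \/ N x by have : setT x by []; rewrite -PN.
have excl x : P x -> N x -> False.
  by move=> Px Nx; have : (P `&` N) x by []; rewrite PN0.
split=> x xs.
  have Px : P x.
    have [//|Nx] := cov x.
    have : (X [set x] <= 0)%E by apply: negN => // _ ->.
    by rewrite leNgt represents_pos xs.
  by split => // /(excl _ Px).
have Nx : N x.
  have [Px|//] := cov x.
  have : (0 <= X [set x])%E by apply: posP => // _ ->.
  by rewrite leNgt represents_neg xs.
by split => // Px; exact: excl Px Nx.
Qed.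

Lemma charge_pos_represents A : measurable A -> charge_pos X A = deltas sp A.
Proof.
move=> mA; have [P [N [h /(_ A mA)[-> _]]]] := charge_parts_hahn X.
have [hp hm] := hahn h; have [[mP _] _ _ _] := h.
have [_ _ _ ->] := rX; last exact: measurableI.
rewrite [X in (_ - X)%E]deltasE big1_seq ?sube0; last first.
  by move=> x /andP[_ /hm[_ nP]]; rewrite memNset// => -[].
rewrite !deltasE; congr (_%:E); apply: eq_big_seq => x /hp[Px _].
by rewrite in_setI (mem_set Px) andbT.
Qed.

Lemma charge_neg_represents A : measurable A -> charge_neg X A = deltas sm A.
Proof.
move=> mA; have [P [N [h /(_ A mA)[_ ->]]]] := charge_parts_hahn X.
have [hp hm] := hahn h; have [_ [mN _] _ _] := h.
have [_ _ _ ->] := rX; last exact: measurableI.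
rewrite [X in (- (X - _))%E]deltasE big1_seq ?sub0e ?oppeK; last first.
  by move=> x /andP[_ /hp[_ nP]]; rewrite memNset// => -[].
rewrite !deltasE; congr (_%:E); apply: eq_big_seq => x /hm[Nx _].
by rewrite in_setI (mem_set Nx) andbT.
Qed.

Lemma linear_functional_represents wm wp :
  measurable_fun `[a, b] wm -> measurable_fun `[a, b] wp ->
  linear_functional a b wm wp X = \sum_(x <- sm) wm x + \sum_(x <- sp) wp x.
Proof.
move=> mwm mwp; have [psub msub _ _] := rX.
have sub : `]a, b[%classic `<=` `[a, b]%classic.
  by move=> x /=; rewrite !in_itv/= => /andP[/ltW-> /ltW->].
have mI : measurable `[a, b]%classic by exact: emeasurable_itv.
rewrite -(@integral_deltas _ `]a, b[ sm)//; last exact: measurable_funS mwm.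
rewrite -(@integral_deltas _ `]a, b[ sp)//; last exact: measurable_funS mwp.
rewrite /linear_functional; congr (fine _ + fine _);
  apply: eq_measure_integral => A mA _.
  exact: charge_neg_represents.
exact: charge_pos_represents.
Qed.

End one_configuration.
End signed_point_configurations.

Section extremal_points.
Context (R : realType).
Implicit Types (s : seq (\bar R)) (x y : \bar R).

Lemma ereal_inf_cons x s : exists2 m, ereal_inf [set y | y \in x :: s] = m &
  m \in x :: s /\ {in x :: s, forall y, (m <= y)%E}.
Proof.
have [m ms mle] : exists2 m, m \in x :: s & {in x :: s, forall y, (m <= y)%E}.
  elim: s => [|z s [m ms mle]].
    by exists x; rewrite ?mem_head// => y; rewrite inE => /eqP->.
  have [zm|mz] := leP z m.
    exists z; first by rewrite !inE eqxx orbT.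
    move=> y; rewrite !inE => /or3P[/eqP->|/eqP->|ys]//.
      by rewrite (le_trans zm)// mle// mem_head.
    by rewrite (le_trans zm)// mle// inE ys orbT.
  exists m; first by move: ms; rewrite !inE => /orP[->//|->]; rewrite !orbT.
  move=> y; rewrite !inE => /or3P[/eqP->|/eqP->|ys].
  - by rewrite mle// mem_head.
  - exact: ltW.
  - by rewrite mle// inE ys orbT.
exists m => //; apply/eqP; rewrite eq_le ereal_inf_lbound//=.
exact: le_ereal_inf_tmp.
Qed.

Lemma ereal_sup_cons x s : exists2 m, ereal_sup [set y | y \in x :: s] = m &
  m \in x :: s /\ {in x :: s, forall y, (y <= m)%E}.
Proof.
have [_ <- [ms mle]] := ereal_inf_cons (- x)%E (map -%E s).
set S := [set y | y \in x :: s].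
set m := ereal_inf _ in ms mle.
have SE : [set y | y \in (- x)%E :: map -%E s] = -%E @` S.
  apply/seteqP; split => [y|_ [y /= ys <-]] /=; last first.
    by rewrite -(map_cons -%E x s) map_f.
  by rewrite -(map_cons -%E x s) => /mapP[z zs ->]; exists z.
have mE : m = (- ereal_sup S)%E by rewrite /m SE ereal_infN.
exists (ereal_sup S) => //; split; last by move=> y ys; apply: ereal_sup_ubound.
by move: ms; rewrite mE -(map_cons -%E x s) mem_map//; exact: oppe_inj.
Qed.

End extremal_points.

(** * The effect of one event on a linear functional *)

Section luckock_moves.
Context (R : realType) (a b : \bar R).
Hypothesis hab : (a < b)%E.
Implicit Types (sp sm : seq (\bar R)) (x y u : \bar R) (wm wp : \bar R -> R).
Implicit Types X : {charge set (\bar R) -> \bar R}.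

Section moves_from_a_configuration.
Variables (sp sm : seq (\bar R)) (X : {charge set (\bar R) -> \bar R}).
Hypothesis rX : represents a b sp sm X.

Lemma Mplus_represents :
  Mplus a b X \in b :: sp /\ {in b :: sp, forall y, (Mplus a b X <= y)%E}.
Proof.
have [psub _ _ _] := rX.
have -> : Mplus a b X = ereal_inf [set y | y \in b :: sp].
  congr ereal_inf; apply/seteqP; split => y /=.
    by move=> [->|[_]]; rewrite inE ?eqxx// (represents_pos rX) orbC => ->.
  rewrite inE => /predU1P[->|ys]; first by left.
  by right; rewrite (represents_pos rX); split => //; exact: psub.
by have [_ <-] := ereal_inf_cons b sp.
Qed.

Lemma Mminus_represents :
  Mminus a b X \in a :: sm /\ {in a :: sm, forall y, (y <= Mminus a b X)%E}.
Proof.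
have [_ msub _ _] := rX.
have -> : Mminus a b X = ereal_sup [set y | y \in a :: sm].
  congr ereal_sup; apply/seteqP; split => y /=.
    by move=> [->|[_]]; rewrite inE ?eqxx// (represents_neg rX) orbC => ->.
  rewrite inE => /predU1P[->|ys]; first by left.
  by right; rewrite (represents_neg rX); split => //; exact: msub.
by have [_ <-] := ereal_sup_cons a sm.
Qed.

Lemma a_lt_Mplus : (a < Mplus a b X)%E.
Proof.
have [psub _ _ _] := rX.
have [+ _] := Mplus_represents; rewrite inE => /predU1P[->//|/psub].
by rewrite in_itv/= => /andP[].
Qed.

Lemma Mminus_lt_b : (Mminus a b X < b)%E.
Proof.
have [_ msub _ _] := rX.
have [+ _] := Mminus_represents; rewrite inE => /predU1P[->//|/msub].
by rewrite in_itv/= => /andP[].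
Qed.

Lemma Mplus_itv : Mplus a b X \in `[a, b].
Proof.
have [_ le] := Mplus_represents.
by rewrite in_itv/= (ltW a_lt_Mplus) le// mem_head.
Qed.

Lemma Mminus_itv : Mminus a b X \in `[a, b].
Proof.
have [_ le] := Mminus_represents.
by rewrite in_itv/= (ltW Mminus_lt_b) le// mem_head.
Qed.

Variables (wm wp : \bar R -> R).
Hypotheses (mwm : measurable_fun `[a, b] wm) (mwp : measurable_fun `[a, b] wp).
Hypotheses (wma : wm a = 0) (wpb : wp b = 0).

(** The conventions at the endpoints make one formula cover all cases: the event does nothing when
    [u = a], or when [M_+ = b] and [u] reaches it, and then the right-hand side is [wm a = 0] or
    [- wp b = 0]. *)
Lemma luckock_step_minus u : u \in `[a, b] ->
  linear_functional a b wm wp (luckock_map a b (u, false) X) -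
  linear_functional a b wm wp X =
  if (u < Mplus a b X)%E then wm u else - wp (Mplus a b X).
Proof.
rewrite in_itv/= => /andP[au ub].
have [psub msub ord XE] := rX; have [Mp Mle] := Mplus_represents.
rewrite (linear_functional_represents rX mwm mwp) /luckock_map/= minEle.
have subE y A : sub_delta X y A = (X A - \d_y A)%E by [].
case: (ltP u (Mplus a b X)) => [uM|Mu].
  rewrite (ltW uM) in_itv/= (lt_le_trans uM (Mle _ (mem_head _ _))) andbT.
  move: au; rewrite le_eqVlt => /predU1P[<-|au].
    by rewrite ltxx (linear_functional_represents rX mwm mwp) subrr wma.
  rewrite au.
  have rX' : represents a b sp (u :: sm) (sub_delta X u).
    split => //.
    - move=> y; rewrite inE => /predU1P[->|/msub//].
      by rewrite in_itv/= au (lt_le_trans uM (Mle _ (mem_head _ _))).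
    - move=> y x; rewrite inE => /predU1P[->|ym] xp; last exact: ord.
      by rewrite (lt_le_trans uM)// Mle// inE xp orbT.
    - move=> A mA; rewrite subE XE// deltas_cons diracE !deltasE -!(EFinN, EFinD).
      by congr (_%:E); ring.
  rewrite (linear_functional_represents rX' mwm mwp) big_cons; ring.
(* On a tie [u = M_+] both branches of the minimum agree. *)
rewrite (_ : (if _ then _ else _) = Mplus a b X); last first.
  by case: ifPn => // uM; apply/eqP; rewrite eq_le uM Mu.
move: Mp; rewrite inE => /predU1P[ME|Mp].
  rewrite ME in_itv/= ltxx andbF (linear_functional_represents rX mwm mwp).
  by rewrite subrr wpb oppr0.
rewrite psub//.
have rX' : represents a b (rem (Mplus a b X) sp) sm (sub_delta X (Mplus a b X)).
  split => //.
  - by move=> x /mem_rem/psub.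
  - by move=> y x ym /mem_rem xp; exact: ord.
  - move=> A mA; rewrite subE XE// (deltas_rem A Mp).
    rewrite diracE !deltasE -!(EFinN, EFinD).
    by congr (_%:E); ring.
rewrite (linear_functional_represents rX' mwm mwp).
rewrite (perm_big _ (perm_to_rem Mp)) big_cons/=; ring.
Qed.

Lemma luckock_step_plus u : u \in `[a, b] ->
  linear_functional a b wm wp (luckock_map a b (u, true) X) -
  linear_functional a b wm wp X =
  if (Mminus a b X < u)%E then wp u else - wm (Mminus a b X).
Proof.
rewrite in_itv/= => /andP[au ub].
have [psub msub ord XE] := rX; have [Mp Mle] := Mminus_represents.
rewrite (linear_functional_represents rX mwm mwp) /luckock_map/= maxEle.
have addE y A : add_delta X y A = (X A + \d_y A)%E by [].
case: (ltP (Mminus a b X) u) => [Mu|uM].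
  rewrite in_itv/=.
  rewrite (le_lt_trans (Mle _ (mem_head _ _)) Mu)/=.
  move: ub; rewrite le_eqVlt => /predU1P[->|ub].
    by rewrite ltxx (linear_functional_represents rX mwm mwp) subrr wpb.
  rewrite ub.
  have rX' : represents a b (u :: sp) sm (add_delta X u).
    split => //.
    - move=> y; rewrite inE => /predU1P[->|/psub//].
      by rewrite in_itv/= ub (le_lt_trans (Mle _ (mem_head _ _)) Mu).
    - move=> y x ym; rewrite inE => /predU1P[->|xp]; last exact: ord.
      by rewrite (le_lt_trans _ Mu)// Mle// inE ym orbT.
    - by move=> A mA; rewrite addE XE// deltas_cons addeAC [(\d__ _ + _)%E]addeC.
  rewrite (linear_functional_represents rX' mwm mwp) big_cons; ring.
move: Mp; rewrite inE => /predU1P[ME|Mp].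
  rewrite ME in_itv/= ltxx (linear_functional_represents rX mwm mwp).
  by rewrite subrr wma oppr0.
rewrite msub//.
have rX' : represents a b sp (rem (Mminus a b X) sm) (add_delta X (Mminus a b X)).
  split => //.
  - by move=> x /mem_rem/msub.
  - by move=> y x /mem_rem ym xp; exact: ord.
  - move=> A mA; rewrite addE XE// (deltas_rem A Mp).
    rewrite diracE !deltasE -!(EFinN, EFinD).
    by congr (_%:E); ring.
rewrite (linear_functional_represents rX' mwm mwp).
rewrite (perm_big _ (perm_to_rem Mp)) big_cons/=; ring.
Qed.

End moves_from_a_configuration.

(** At most one atom of each sign is enough; the values [a] and [b] are attained by leaving the atom
    out. *)
Lemma configuration_exists x y : x \in `[a, b] -> y \in `[a, b] -> (x < y)%E ->
  exists X, [/\ Sord_fin a b X, Mminus a b X = x & Mplus a b X = y].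
Proof.
move=> xab yab xy.
pose sm := if x == a then [::] else [:: x].
pose sp := if y == b then [::] else [:: y].
pose Xm : {charge set (\bar R) -> \bar R} :=
  let X0 : {charge set (\bar R) -> \bar R} := czero in
  if x == a then X0 else sub_delta X0 x.
pose X : {charge set (\bar R) -> \bar R} := if y == b then Xm else add_delta Xm y.
have rX : represents a b sp sm X.
  split.
  - move=> u; rewrite /sp; case: ifPn => // yb; rewrite inE => /eqP ->.
    by rewrite in_itv/= (lt_neqAle y b) yb (itvP yab) (le_lt_trans _ xy)// (itvP xab).
  - move=> u; rewrite /sm; case: ifPn => // xa; rewrite inE => /eqP ->.
    by rewrite in_itv/= (lt_neqAle a x) eq_sym xa (itvP xab)
      (lt_le_trans xy)// (itvP yab).
  - move=> u v; rewrite /sm /sp; case: ifP => // _; case: ifP => // _.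
    by rewrite !inE => /eqP-> /eqP->.
  - move=> A mA; rewrite /X /Xm /sm /sp.
    have addE Y u : add_delta Y u A = (Y A + \d_u A)%E by [].
    have subE Y u : sub_delta Y u A = (Y A - \d_u A)%E by [].
    have zeroE : (czero : {charge set (\bar R) -> \bar R}) A = 0%:E by [].
    case: ifP => _; case: ifP => _;
      rewrite ?addE ?subE zeroE ?diracE !deltasE ?big_cons !big_nil;
      rewrite -!(EFinN, EFinD); congr (_%:E); ring.
exists X; split; first by apply/Sord_finP; exists sp, sm.
- have [ms mle] := Mminus_represents rX.
  apply/eqP; rewrite eq_le; apply/andP; split.
    move: ms; rewrite /sm; case: (eqVneq x a) => [->|_].
      by rewrite !inE => /eqP ->.
    by rewrite !inE => /orP[/eqP->|/eqP ->//]; rewrite (itvP xab).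
  by apply: mle; rewrite /sm; case: (eqVneq x a) => [->|_]; rewrite !inE eqxx ?orbT.
- have [ps ple] := Mplus_represents rX.
  apply/eqP; rewrite eq_le; apply/andP; split.
    by apply: ple; rewrite /sp; case: (eqVneq y b) => [->|_]; rewrite !inE eqxx ?orbT.
  move: ps; rewrite /sp; case: (eqVneq y b) => [->|_].
    by rewrite !inE => /eqP ->.
  by rewrite !inE => /orP[/eqP->|/eqP ->//]; rewrite (itvP yab).
Qed.

End luckock_moves.

(** * The generator on linear functionals *)

Section order_measure_intervals.
Context (R : realType) (a b : \bar R).
Variables (m : {finite_measure set (\bar R) -> \bar R}) (l : \bar R -> R).
Hypothesis l_cont : {within `[a, b], continuous l}.
Implicit Types x y : \bar R.

(** Additivity gives the mass of half-open intervals [[u, y[]. Continuity of [l] removes the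
    possible atom at [x], by comparison with [[u, y[] for [u] slightly above [x]. *)
Lemma closed_left_measureE :
  (forall x, x \in `[a, b] -> m `[x, b]%classic = (l x)%:E) ->
  {in `[a, b] &, forall x y, (x < y)%E ->
    m `]x, y[%classic = (- l y - - l x)%:E}.
Proof.
move=> ml x y xab yab xy.
have mE u : u \in `[a, b] -> (u < y)%E -> m `[u, y[%classic = (l u - l y)%:E.
  move=> uab uy.
  have E : `[u, b]%classic = `[u, y[%classic `|` `[y, b]%classic.
    apply/seteqP; split => v /=; rewrite !in_itv/=.
      by move=> /andP[uv vb]; case: (ltP v y) => vy; [left; rewrite uv|right].
    move=> [/andP[-> /ltW vy]|/andP[yv ->]].
      by rewrite (le_trans vy)// (itvP yab).
    by rewrite (le_trans (ltW uy) yv).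
  have mU : m `[u, b]%classic = (m `[u, y[%classic + m `[y, b]%classic)%E.
    rewrite E measureU//; apply/seteqP; split => // v /=; rewrite !in_itv/=.
    by move=> [/andP[_ vy] /andP[yv _]]; have := lt_le_trans vy yv; rewrite ltxx.
  move: mU; rewrite !ml//.
  have : m `[u, y[%classic \is a fin_num by rewrite fin_num_measure.
  case: (m `[u, y[%classic) => // r _ [h]; congr (_%:E); lra.
have := mE x xab xy.
have : (m `]x, y[%classic <= m `[x, y[%classic)%E.
  rewrite le_measure ?inE// => v /=; rewrite !in_itv/= => /andP[/ltW -> ->//].
have : m `]x, y[%classic \is a fin_num by rewrite fin_num_measure.
move rE : (m `]x, y[%classic) => v; case: v rE => // r rE _ + xyE.
rewrite xyE lee_fin => rle; congr (_%:E); apply: le_anti; rewrite opprK addrC rle/=.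
rewrite leNgt; apply/negP => rlt.
(* Half of the mass supposed to be missing: for [u] close to [x], the smaller interval [[u, y[]
   would then outweigh []x, y[]. *)
have e0 : 0 < (l x - l y - r) / 2 by lra.
have [u [xu uy]] := nbhs_right_exists (within_near l_cont xab e0) xy.
have uab : u \in `[a, b] by exact: itv_convex xab yab (ltW xu) (ltW uy).
move=> /(_ uab).
have : (m `[u, y[%classic <= m `]x, y[%classic)%E.
  rewrite le_measure ?inE// => v /=; rewrite !in_itv/= => /andP[uv ->].
  by rewrite (lt_le_trans xu uv).
rewrite mE// rE lee_fin => h1 h2.
have := ler_norm (- (l u - l x)); rewrite normrN; lra.
Qed.

Lemma closed_right_measureE :
  (forall x, x \in `[a, b] -> m `[a, x]%classic = (l x)%:E) ->
  {in `[a, b] &, forall x y, (x < y)%E ->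
    m `]x, y[%classic = (l y - l x)%:E}.
Proof.
move=> ml x y xab yab xy.
have mE u : u \in `[a, b] -> (x < u)%E -> m `]x, u]%classic = (l u - l x)%:E.
  move=> uab xu.
  have E : `[a, u]%classic = `[a, x]%classic `|` `]x, u]%classic.
    apply/seteqP; split => v /=; rewrite !in_itv/=.
      by move=> /andP[av vu]; case: (leP v x) => vx; [left; rewrite av|right].
    move=> [/andP[-> vx]|/andP[xv ->]].
      by rewrite (le_trans vx)// ltW.
    by rewrite (le_trans _ (ltW xv))// (itvP xab).
  have mU : m `[a, u]%classic = (m `[a, x]%classic + m `]x, u]%classic)%E.
    rewrite E measureU//; apply/seteqP; split => // v /=; rewrite !in_itv/=.
    by move=> [/andP[_ vx] /andP[xv _]]; have := lt_le_trans xv vx; rewrite ltxx.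
  move: mU; rewrite !ml//.
  have : m `]x, u]%classic \is a fin_num by rewrite fin_num_measure.
  case: (m `]x, u]%classic) => // r _ [h]; congr (_%:E); lra.
have := mE y yab xy.
have : (m `]x, y[%classic <= m `]x, y]%classic)%E.
  rewrite le_measure ?inE// => v /=; rewrite !in_itv/= => /andP[-> /ltW ->//].
have : m `]x, y[%classic \is a fin_num by rewrite fin_num_measure.
move rE : (m `]x, y[%classic) => v; case: v rE => // r rE _ + xyE.
rewrite xyE lee_fin => rle; congr (_%:E); apply: le_anti; rewrite rle/=.
rewrite leNgt; apply/negP => rlt.
have e0 : 0 < (l y - l x - r) / 2 by lra.
have [u [xu uy]] := nbhs_left_exists (within_near l_cont yab e0) xy.
have uab : u \in `[a, b] by exact: itv_convex xab yab (ltW xu) (ltW uy).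
move=> /(_ uab).
have : (m `]x, u]%classic <= m `]x, y[%classic)%E.
  rewrite le_measure ?inE// => v /=; rewrite !in_itv/= => /andP[-> vu].
  by rewrite (le_lt_trans vu uy).
rewrite mE// rE lee_fin => h1 h2.
have := ler_norm (- (l u - l y)); rewrite normrN; lra.
Qed.

End order_measure_intervals.

(** * Splitting an integral over events by their sign *)

Section signed_measure_integral.
Context d (T : measurableType d) (R : realType).
Variables (mu : {measure set (T * bool) -> \bar R}).
Variables (mum mup : {finite_measure set T -> \bar R}).
Hypothesis muE : forall A, measurable A ->
  mu (A `*` [set false]) = mum A /\ mu (A `*` [set true]) = mup A.

Let mpair (s : bool) : measurable_fun setT (fun x : T => (x, s)).
Proof. exact: pair2_measurable. Qed.

Let integral_section (ms : {finite_measure set T -> \bar R}) (s : bool)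
    (D : set T) (h : T * bool -> R) (M : R) :
  (forall A, measurable A -> mu (A `*` [set s]) = ms A) ->
  measurable D -> measurable_fun D (fun u => h (u, s)) ->
  (forall u, D u -> `|h (u, s)| <= M) ->
  mu.-integrable (D `*` [set s]) (EFin \o h) /\
  \int[mu]_(p in D `*` [set s]) h p = \int[ms]_(u in D) h (u, s).
Proof.
move=> msE mD mh hM.
have mDs : measurable (D `*` [set s]) by exact: measurableX.
(* Only the section of [h] at [s] on [D] is known to be measurable. Its extension by zero, read
   through the first projection, is measurable on the whole product and agrees with [h] on
   [D * {s}]. *)
pose g (p : T * bool) := ((fun u => h (u, s)) \_ D) p.1.
have mg : measurable_fun setT g.
  have mr : measurable_fun setT ((fun u => h (u, s)) \_ D).
    exact/(measurable_restrictT _ mD).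
  exact: (measurableT_comp mr measurable_fst).
have gE p : (D `*` [set s]) p -> g p = h p.
  by case: p => u t [/= Du ->]; rewrite /g /= patchE mem_set.
have mhs : measurable_fun (D `*` [set s]) h.
  apply: (@eq_measurable_fun _ _ _ _ _ g); last exact: measurable_funTS.
  by move=> p /[!inE]; exact: gE.
have bh : forall p, (D `*` [set s]) p -> `|h p| <= M.
  by case=> u t [/= Du ->]; exact: hM.
split.
  apply: measurable_bounded_integrable => //.
    by rewrite msE// ltey_eq fin_num_measure.
  exact: bounded_on bh.
have -> : \int[mu]_(p in D `*` [set s]) h p = \int[mu]_(p in D `*` [set s]) g p.
  by apply: eq_Rintegral => p /[!inE] /gE.
(* On subsets of [D * {s}], [mu] is the image of [ms] under [u |-> (u, s)]. *)
pose ns := @measure_function_pushforward__canonical__measure_function_Measure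
  _ _ _ _ _ ms _ (mpair s).
congr fine.
rewrite (@eq_measure_integral _ _ _ _ ns); last first.
  move=> A mA AD.
  have -> : A = ((fun u => (u, s)) @^-1` A) `*` [set s].
    apply/seteqP; split => [[u t] Aut|[u t] [/= + ->]//].
    by have [/= _ ts] := AD _ Aut; rewrite -ts.
  rewrite msE; last by rewrite -[X in measurable X]setTI; exact: mpair.
  congr (ms _); apply/seteqP; split => [u//|u /= []//].
have E : (fun u => (u, s)) @^-1` (D `*` [set s]) = D.
  by apply/seteqP; split => [u []|u].
have gD u : D u -> g (u, s) = h (u, s) by move=> Du; apply: gE.
rewrite [LHS](@integral_pushforward _ _ _ _ _ _ (mpair s) ms)//.
- rewrite E; apply: eq_integral => u /[!inE] Du /=; by rewrite gD.
- exact/measurable_EFinP.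
- rewrite E; apply: measurable_bounded_integrable => //.
  + by rewrite ltey_eq fin_num_measure.
  + by apply: measurable_funTS; apply: measurableT_comp.
  + by apply: (@bounded_on _ _ _ _ M) => u Du /=; rewrite gD// hM.
Qed.

Lemma Rintegral_signed (D : set T) (h : T * bool -> R) (M : R) : measurable D ->
  measurable_fun D (fun u => h (u, false)) ->
  measurable_fun D (fun u => h (u, true)) ->
  (forall u s, D u -> `|h (u, s)| <= M) ->
  \int[mu]_(p in D `*` setT) h p =
  \int[mum]_(u in D) h (u, false) + \int[mup]_(u in D) h (u, true).
Proof.
move=> mD mf mt hM.
have [if_ <-] := @integral_section mum false D h M
  (fun A mA => proj1 (muE mA)) mD mf (fun u => hM u false).
have [it <-] := @integral_section mup true D h M
  (fun A mA => proj2 (muE mA)) mD mt (fun u => hM u true).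
have mX (s : bool) : measurable (D `*` [set s] : set (T * bool)).
  exact: measurableX.
have fin s : (mu (D `*` [set s]) < +oo)%E.
  have [f t] := muE mD.
  by case: s; rewrite ?f ?t ltey_eq fin_num_measure.
have -> : D `*` setT = (D `*` [set false]) `|` (D `*` [set true]).
  by apply/seteqP; split => [[u [|]] [/= Du _]|[u t] [[/= Du _]|[/= Du _]]];
    [right|left| |].
rewrite Rintegral_setU//.
- apply: measurable_bounded_integrable.
  + exact: measurableU.
  + apply: (le_lt_trans (measureU2 _ (mX false) (mX true))).
    exact: lte_add_pinfty (fin false) (fin true).
  + apply/measurable_funU => //; split; apply/measurable_EFinP.
      exact: measurable_int if_.
    exact: measurable_int it.
  + by apply: (@bounded_on _ _ _ _ M); case=> u t [[/= Du _]|[/= Du _]]; exact: hM.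
- apply/disj_set2P/seteqP; split => // -[u t] [[/= _ ->] [/= _]] //.
Qed.

End signed_measure_integral.

Section Rintegral_pieces.
Context (R : realType) (m : {finite_measure set (\bar R) -> \bar R}).

Lemma measurable_pieces (A B D : set (\bar R)) (t : \bar R) (h w : \bar R -> R) (c : R) :
  measurable A -> measurable B -> D = A `|` (B `|` [set t]) ->
  (forall u, A u -> h u = c) -> (forall u, B u -> h u = w u) ->
  measurable_fun B w -> measurable_fun D h.
Proof.
move=> mA mB -> hA hB mw.
have mBt : measurable (B `|` [set t]) by exact: measurableU.
apply/measurable_funU => //; split.
  apply: (@eq_measurable_fun _ _ _ _ _ (cst c)) => //.
  by move=> u /[!inE] /hA.
apply/measurable_funU => //; split; last exact: measurable_fun_set1.
by apply: (@eq_measurable_fun _ _ _ _ _ w) => // u /[!inE] /hB.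
Qed.

(** As [h] vanishes at [t], any mass at [t] drops out of the integral. In the generator this zero is
    [wm a] or [wp b]. *)
Lemma Rintegral_pieces (A B D : set (\bar R)) (t : \bar R) (h w : \bar R -> R)
    (c M : R) :
  measurable A -> measurable B -> D = A `|` (B `|` [set t]) ->
  [disjoint A & B `|` [set t]] -> [disjoint B & [set t]] ->
  (forall u, A u -> h u = c) -> (forall u, B u -> h u = w u) -> h t = 0 ->
  measurable_fun B w -> (forall u, D u -> `|h u| <= M) ->
  \int[m]_(u in D) h u = c * fine (m A) + \int[m]_(u in B) w u.
Proof.
move=> mA mB DE dA dB hA hB ht mw hM.
have mBt : measurable (B `|` [set t]) by exact: measurableU.
have mh := measurable_pieces mA mB DE hA hB mw.
have mD : measurable D by rewrite DE; exact: measurableU.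
have ih : m.-integrable D (EFin \o h).
  apply: measurable_bounded_integrable => //; last exact: bounded_on hM.
  by rewrite ltey_eq fin_num_measure.
rewrite DE in ih *; rewrite Rintegral_setU//.
rewrite Rintegral_setU//; last first.
  by apply: integrableS ih; [exact: measurableU| |move=> u; right].
rewrite (@eq_Rintegral _ _ _ _ A (cst c)); last by move=> u /[!inE] /hA.
rewrite (@eq_Rintegral _ _ _ _ B w); last by move=> u /[!inE] /hB.
rewrite (@eq_Rintegral _ _ _ _ [set t] (cst 0)); last by move=> u /[!inE] ->.
by rewrite !Rintegral_cst// mul0r addr0.
Qed.

End Rintegral_pieces.

Section generator_formula.
Context (R : realType) (a b : \bar R) (lm lp : \bar R -> R).
Hypothesis hab : (a < b)%E.
Variables (mum mup : {finite_measure set (\bar R) -> \bar R}).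
Variable mu : {measure set (\bar R * bool) -> \bar R}.
Hypothesis mumE : forall x, x \in `[a, b] -> mum `[x, b]%classic = (lm x)%:E.
Hypothesis mupE : forall x, x \in `[a, b] -> mup `[a, x]%classic = (lp x)%:E.
Hypothesis muE : forall A, measurable A ->
  mu (A `*` [set false]) = mum A /\ mu (A `*` [set true]) = mup A.
Implicit Types (wm wp : \bar R -> R) (x y : \bar R).

Lemma weight_functions_measurable wm wp : weight_functions a b wm wp ->
  measurable_fun `[a, b] wm /\ measurable_fun `[a, b] wp.
Proof.
move=> [_ lw rw _ _]; split; first exact: left_continuous_measurable.
exact: right_continuous_measurable.
Qed.

Lemma bounded_integrable (m : {measure set (\bar R) -> \bar R}) (w : \bar R -> R)
    (M : R) : (m `[a, b]%classic < +oo)%E -> measurable_fun `[a, b] w ->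
  (forall x, x \in `[a, b] -> `|w x| <= M) -> m.-integrable `[a, b] (EFin \o w).
Proof.
move=> moo mw wM; apply: measurable_bounded_integrable => //.
by apply: (@bounded_on _ _ _ _ M) => x /=; exact: wM.
Qed.

Lemma weight_functions_integrable (m : {finite_measure set (\bar R) -> \bar R})
    wm wp : weight_functions a b wm wp ->
  m.-integrable `[a, b] (EFin \o wm) /\ m.-integrable `[a, b] (EFin \o wp).
Proof.
move=> wmp; have [mm mp] := weight_functions_measurable wmp.
have [[M wM] _ _ _ _] := wmp.
have moo : (m `[a, b]%classic < +oo)%E by rewrite ltey_eq fin_num_measure.
by split; apply: (bounded_integrable (M := M)) => // x /wM[].
Qed.

(* The contributions of the minus and plus events to [GF], as functions of
   [M_+] and of [M_-]. *)
Definition minus_rate wm wp y := \int[mum]_(u in `]a, y[) wm u - wp y * lm y.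

Definition plus_rate wm wp x := \int[mup]_(u in `]x, b[) wp u - wm x * lp x.

Lemma generatorE wm wp X : weight_functions a b wm wp -> Sord_fin a b X ->
  generator a b mu (linear_functional a b wm wp) X =
  minus_rate wm wp (Mplus a b X) + plus_rate wm wp (Mminus a b X).
Proof.
move=> wmp /Sord_finP[sp [sm rX]].
have [[M wM] _ _ wma wpb] := wmp.
have [mm mp] := weight_functions_measurable wmp.
have step1 := luckock_step_minus rX mm mp wma wpb.
have step2 := luckock_step_plus rX mm mp wma wpb.
have yab := Mplus_itv hab rX; have ay := a_lt_Mplus hab rX.
have xab := Mminus_itv hab rX; have xb := Mminus_lt_b hab rX.
set y := Mplus a b X in step1 yab ay *; set x := Mminus a b X in step2 xab xb *.
have [aI bI] : a \in `[a, b] /\ b \in `[a, b] by rewrite a_itv ?b_itv.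
rewrite /generator.
set h := fun p => _ - _.
have hF u : u \in `[a, b] ->
    h (u, false) = if (u < y)%E then wm u else - wp y by exact: step1.
have hT u : u \in `[a, b] ->
    h (u, true) = if (x < u)%E then wp u else - wm x by exact: step2.
clearbody h; clear step1 step2.
have hM u s : `[a, b]%classic u -> `|h (u, s)| <= M.
  move=> /= uab; case: s; [rewrite hT//|rewrite hF//]; case: ifP => _;
    rewrite ?normrN.
  - by have [] := wM u uab.
  - by have [] := wM x xab.
  - by have [] := wM u uab.
  - by have [] := wM y yab.
have subl : `]a, y[%classic `<=` `[a, b]%classic by exact: itv_subset.
have subr : `]x, b[%classic `<=` `[a, b]%classic by exact: itv_subset.
(* Minus events in [[y, b]] all remove the order at [y]; their total rate [lm y] includes the atom
   at [b]. Those in []a, y[] place a new order, and [a] contributes nothing. *)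
have Dm : `[a, b]%classic = `[y, b]%classic `|` (`]a, y[%classic `|` [set a]).
  apply/seteqP; split => u /=; rewrite !in_itv/=.
    move=> /andP[au ub]; case: (ltP u y) => uy; last by left.
    by right; move: au; rewrite le_eqVlt => /predU1P[->|->]; [right|left].
  move=> [/andP[yu ->]|[/andP[au uy]|->]].
  - by rewrite (le_trans (ltW ay) yu).
  - by rewrite (ltW au) (le_trans (ltW uy))// (itvP yab).
  - by rewrite lexx ltW.
have Dp : `[a, b]%classic = `[a, x]%classic `|` (`]x, b[%classic `|` [set b]).
  apply/seteqP; split => u /=; rewrite !in_itv/=.
    move=> /andP[au ub]; case: (leP u x) => ux; first by left; rewrite au.
    by right; move: ub; rewrite le_eqVlt => /predU1P[->|->]; [right|left].
  move=> [/andP[-> ux]|[/andP[xu ub]|->]].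
  - by rewrite (le_trans ux (ltW xb)).
  - by rewrite (ltW ub) (le_trans _ (ltW xu))// (itvP xab).
  - by rewrite lexx ltW.
have dm1 : [disjoint `[y, b]%classic & `]a, y[%classic `|` [set a]].
  apply/disj_set2P/seteqP; split => // u /= []; rewrite !in_itv/= => /andP[yu _].
  by move=> [/andP[_ /(le_lt_trans yu)]|ua]; [|move: yu; rewrite ua leNgt ay];
     rewrite ?ltxx.
have dm2 : [disjoint `]a, y[%classic & [set a]].
  apply/disj_set2P/seteqP; split => // u /= []; rewrite !in_itv/= => /andP[au _] ua.
  by rewrite ua ltxx in au.
have dp1 : [disjoint `[a, x]%classic & `]x, b[%classic `|` [set b]].
  apply/disj_set2P/seteqP; split => // u /= []; rewrite !in_itv/= => /andP[_ ux].
  by move=> [/andP[/lt_le_trans/(_ ux)]|ub]; [|move: ux; rewrite ub leNgt xb];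
     rewrite ?ltxx.
have dp2 : [disjoint `]x, b[%classic & [set b]].
  apply/disj_set2P/seteqP; split => // u /= []; rewrite !in_itv/= => /andP[_ ub] ub'.
  by rewrite ub' ltxx in ub.
have mwml : measurable_fun `]a, y[ wm by exact: measurable_funS mm.
have mwpr : measurable_fun `]x, b[ wp by exact: measurable_funS mp.
have hmA u : `[y, b]%classic u -> h (u, false) = - wp y.
  move=> uyb; have uab : u \in `[a, b] by have : `[a, b]%classic u by rewrite Dm; left.
  by rewrite hF// ltNge; move: uyb; rewrite /= in_itv/= => /andP[->].
have hmB u : `]a, y[%classic u -> h (u, false) = wm u.
  move=> uay; rewrite hF; last exact: subl.
  by move: uay; rewrite /= in_itv/= => /andP[_ ->].
have hpA u : `[a, x]%classic u -> h (u, true) = - wm x.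
  move=> uax; have uab : u \in `[a, b] by have : `[a, b]%classic u by rewrite Dp; left.
  by rewrite hT// ltNge; move: uax; rewrite /= in_itv/= => /andP[_ ->].
have hpB u : `]x, b[%classic u -> h (u, true) = wp u.
  move=> uxb; rewrite hT; last exact: subr.
  by move: uxb; rewrite /= in_itv/= => /andP[->].
have hma : h (a, false) = 0 by rewrite hF// ay.
have hpb : h (b, true) = 0 by rewrite hT// xb.
have mhm := measurable_pieces (emeasurable_itv _) (emeasurable_itv _) Dm hmA hmB mwml.
have mhp := measurable_pieces (emeasurable_itv _) (emeasurable_itv _) Dp hpA hpB mwpr.
rewrite (Rintegral_signed muE _ mhm mhp hM)//.
rewrite (Rintegral_pieces mum _ _ Dm dm1 dm2 hmA hmB hma mwml (hM^~ false))//.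
rewrite (Rintegral_pieces mup _ _ Dp dp1 dp2 hpA hpB hpb mwpr (hM^~ true))//.
rewrite mumE// mupE//= /minus_rate /plus_rate; ring.
Qed.

End generator_formula.

(** * Existence and uniqueness of the weights *)

Section stieltjes_algebra.
Context (R : realType) (a b : \bar R).
Implicit Types w L V G f : \bar R -> R.

Lemma stieltjes_shift w L V G G' (c : R) : stieltjes a b w L V G ->
  {in `[a, b], forall x, G' x = G x + c} -> stieltjes a b w L V G'.
Proof.
move=> sG GE x y xab yab xy k e wk; rewrite !GE//.
have -> : G y + c - (G x + c) = G y - G x by ring.
exact: sG.
Qed.

Lemma stieltjesNN w L V G : stieltjes a b w L V G ->
  stieltjes a b w (fun x => - L x) V (fun x => - G x).
Proof.
move=> sG x y xab yab xy k e wk; rewrite -normrN.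
have -> : - (- G y - - G x - k * (- L y - - L x)) = G y - G x - k * (L y - L x).
  by ring.
exact: sG.
Qed.

(** The choice [k = 0] bounds the increments of [G] by a multiple of those of [V]. *)
Lemma stieltjes_continuous w L V G (M : R) :
  {within `[a, b], continuous V} ->
  {in `[a, b] &, forall x y, (x <= y)%E -> V x <= V y} ->
  {in `[a, b], forall x, `|w x| <= M} ->
  stieltjes a b w L V G -> {within `[a, b], continuous G}.
Proof.
move=> cV Vle wM sG; apply/subspace_continuousP => t tab.
apply/cvgrPdist_le => e e0; rewrite near_withinE.
have M10 : 0 < `|M| + 1 by rewrite ltr_wpDl.
have GV : {in `[a, b] &, forall x y, (x <= y)%E ->
    `|G y - G x| <= (`|M| + 1) * `|V y - V x|}.
  move=> x y xab yab xy; have -> : G y - G x = G y - G x - 0 * (L y - L x) by ring.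
  rewrite (le_trans (sG x y xab yab xy 0 (`|M| + 1) _))//.
    move=> u /andP[xu uy]; rewrite subr0.
    rewrite (le_trans (wM u _)) ?(itv_convex xab yab xu uy)//.
    by rewrite (le_trans (ler_norm _))// lerDl.
  by rewrite ler_pM2l// ler_norm.
apply: filterS (within_near cV tab (divr_gt0 e0 M10)) => y Vy yab.
have {}Vy := Vy yab; rewrite ler_pdivlMr// mulrC in Vy.
have [ty|/ltW yt] := leP t y.
  by rewrite distrC (le_trans (GV t y tab yab ty)).
by rewrite (le_trans (GV y t yab tab yt))// distrC.
Qed.

(** Compare [f x] with [f a] along the partition [a < x < b]. *)
Lemma bounded_variation_bounded f : (a < b)%E -> bounded_variation_on a b f ->
  exists M : R, {in `[a, b], forall x, `|f x| <= M}.
Proof.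
move=> hab [M fM]; exists (`|f a| + `|M|) => x.
rewrite in_itv/= le_eqVlt => /andP[/predU1P[<- _|ax]].
  by rewrite lerDl.
have tri (y : R) : `|f x - f a| + `|y| <= M -> `|f x| <= `|f a| + `|M|.
  move=> h; have := ler_normD (f x - f a) (f a); rewrite subrK.
  have := ler_norm M; have := normr_ge0 y; lra.
rewrite le_eqVlt => /predU1P[xb|xb].
  apply: (tri 0); rewrite normr0 addr0.
  have := fM [:: b]; rewrite /= big_seq1/= hab => /(_ isT erefl).
  by rewrite xb.
apply: (tri (f b - f x)).
have := fM [:: x; b]; rewrite /= !big_cons big_nil/= ax xb addr0.
exact.
Qed.

End stieltjes_algebra.

(** * From signed measures to primitives in Luckock's equation *)

Section luckock_solutions.
Context (R : realType) (a b : \bar R) (lm lp fm fp : \bar R -> R).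
Hypothesis (hab : (a < b)%E).
Hypothesis (lm_cont : {within `[a, b], continuous lm}).
Hypothesis (lp_cont : {within `[a, b], continuous lp}).
Hypothesis (lm_noninc : {in `[a, b] &, forall x y, (x <= y)%E -> lm y <= lm x}).
Hypothesis (lp_nondec : {in `[a, b] &, forall x y, (x <= y)%E -> lp x <= lp y}).
Hypotheses (lp_gt0 : 0 < lp a) (lm_gt0 : 0 < lm b).
Variables (mum mup : {finite_measure set (\bar R) -> \bar R}).
Hypothesis mumL : {in `[a, b] &, forall x y, (x < y)%E ->
  mum `]x, y[%classic = (- lm y - - lm x)%:E}.
Hypothesis mupL : {in `[a, b] &, forall x y, (x < y)%E ->
  mup `]x, y[%classic = (lp y - lp x)%:E}.
Implicit Types (w : \bar R -> R) (x y : \bar R).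

Let aI : a \in `[a, b] := a_itv hab.
Let bI : b \in `[a, b] := b_itv hab.
Let lm_pos x : x \in `[a, b] -> 0 < lm x.
Proof. exact: lm_itv_gt0 hab lm_noninc lm_gt0 x. Qed.
Let lp_pos x : x \in `[a, b] -> 0 < lp x.
Proof. exact: lp_itv_gt0 hab lp_nondec lp_gt0 x. Qed.
Let lm0 : {in `[a, b], forall x, lm x != 0}.
Proof. by move=> x /lm_pos; rewrite lt0r => /andP[]. Qed.
Let lp0 : {in `[a, b], forall x, lp x != 0}.
Proof. by move=> x /lp_pos; rewrite lt0r => /andP[]. Qed.

Lemma within_measurable w : {within `[a, b], continuous w} ->
  measurable_fun `[a, b] w.
Proof. by move=> cw; apply/left_continuous_measurable/within_left_continuous. Qed.

Lemma lm_bounded x : x \in `[a, b] -> `|lm x| <= lm a.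
Proof.
move=> xab; rewrite gtr0_norm ?lm_pos//.
by rewrite lm_noninc// (itvP xab).
Qed.

Lemma lp_bounded x : x \in `[a, b] -> `|lp x| <= lp b.
Proof.
move=> xab; rewrite gtr0_norm ?lp_pos//.
by rewrite lp_nondec// (itvP xab).
Qed.

Lemma div_lm_bounded w M : {in `[a, b], forall x, `|w x| <= M} ->
  {in `[a, b], forall x, `|w x / lm x| <= M / lm b}.
Proof.
move=> wM x xab; have lmx := lm_pos xab; have le := ge_lm_b hab lm_noninc xab.
rewrite normrM normfV (gtr0_norm lmx) ler_pM ?invr_ge0 ?(ltW lmx) ?wM//.
by rewrite lef_pV2 ?posrE.
Qed.

Lemma div_lp_bounded w M : {in `[a, b], forall x, `|w x| <= M} ->
  {in `[a, b], forall x, `|w x / lp x| <= M / lp a}.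
Proof.
move=> wM x xab; have lpx := lp_pos xab; have le := ge_lp_a hab lp_nondec xab.
rewrite normrM normfV (gtr0_norm lpx) ler_pM ?invr_ge0 ?(ltW lpx) ?wM//.
by rewrite lef_pV2 ?posrE.
Qed.

Lemma within_integrable (m : {measure set (\bar R) -> \bar R}) w M :
  (m `[a, b]%classic < +oo)%E -> {within `[a, b], continuous w} ->
  {in `[a, b], forall x, `|w x| <= M} -> m.-integrable `[a, b] (EFin \o w).
Proof.
move=> moo cw wM; apply: bounded_integrable (wM) => //.
exact: within_measurable.
Qed.

Section solution.
Hypothesis hf : luckock_solution a b lm lp fm fp.

Lemma fm_continuous : {within `[a, b], continuous fm}.
Proof. by have [[]] := hf. Qed.

Lemma fp_continuous : {within `[a, b], continuous fp}.
Proof. by have [[]] := hf. Qed.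

Lemma fm_bounded : exists M : R, {in `[a, b], forall x, `|fm x| <= M}.
Proof. by have [_ [h _] _ _] := hf; exact: bounded_variation_bounded. Qed.

Lemma fp_bounded : exists M : R, {in `[a, b], forall x, `|fp x| <= M}.
Proof. by have [_ [_ h] _ _] := hf; exact: bounded_variation_bounded. Qed.

Lemma div_fp_integrable (m : {finite_measure set (\bar R) -> \bar R}) :
  m.-integrable `[a, b] (EFin \o (fun x => fp x / lp x)).
Proof.
have [M fM] := fp_bounded.
apply: within_integrable (div_lp_bounded fM).
  by rewrite ltey_eq fin_num_measure//; exact: emeasurable_itv.
exact: within_div fp_continuous lp_cont lp0.
Qed.

Lemma div_fm_integrable (m : {finite_measure set (\bar R) -> \bar R}) :
  m.-integrable `[a, b] (EFin \o (fun x => fm x / lm x)).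
Proof.
have [M fM] := fm_bounded.
apply: within_integrable (div_lm_bounded fM).
  by rewrite ltey_eq fin_num_measure//; exact: emeasurable_itv.
exact: within_div fm_continuous lm_cont lm0.
Qed.

Let charge_stieltjes (nu : {charge set (\bar R) -> \bar R}) f w M :
  is_differential a b f nu -> {within `[a, b], continuous w} ->
  {in `[a, b], forall x, `|w x| <= M} ->
  stieltjes a b w f (variation_from a nu)
    (fun x => charge_integral nu `]a, x]%classic w).
Proof.
move=> nuf cw wM; apply: charge_integral_stieltjes => //.
  apply: within_integrable wM => //.
  by rewrite ltey_eq charge_pos_fin_num//; exact: emeasurable_itv.
apply: within_integrable wM => //.
by rewrite ltey_eq charge_neg_fin_num//; exact: emeasurable_itv.
Qed.

Let sub_itv x : x \in `[a, b] -> `]a, x]%classic `<=` `[a, b]%classic.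
Proof.
move=> xab u /=; rewrite !in_itv/= => /andP[/ltW -> ux].
by rewrite (le_trans ux)// (itvP xab).
Qed.

(** This is [fp dlm + lp dfm = 0] divided by [lp]; on open intervals [mum] is the measure [- dlm],
    which accounts for the sign. *)
Lemma fm_increment : {in `[a, b] &, forall x y, (x <= y)%E ->
  \int[mum]_(u in `]x, y[) (fp u / lp u) = fm y - fm x}.
Proof.
move=> x y xab yab xy.
have [_ _ [dlm [dlp [dfm [dfp [[hlm _] [hfm _] _ eq2]]]]] _] := hf.
have [M fM] := fp_bounded.
have i := div_fp_integrable mum.
have s1 := charge_stieltjes hlm fp_continuous fM.
have s2 := charge_stieltjes hfm lp_cont lp_bounded.
(* [differential_ratio] wants one integrator throughout, so [- lm] is turned back into [lm]. *)
have s3 := stieltjesNN (itv_integral_stieltjesl hab mumL i (fun u _ => erefl)).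
have {}s3 : stieltjes a b (fun u => fp u / lp u) lm (fun u => - lm u)
    (fun y => - \int[mum]_(u in `]a, y[) (fp u / lp u)).
  by move: s3; congr (stieltjes _ _ _ _ _ _); apply/funext => u; rewrite opprK.
have eq0 : {in `[a, b], forall u, charge_integral dlm `]a, u]%classic fp +
    charge_integral dfm `]a, u]%classic lp = 0}.
  by move=> u uab; apply: eq2; [exact: emeasurable_itv|exact: sub_itv].
have := differential_ratio fp_continuous lp_cont lp0
  (@variation_from_nondecreasing _ a b dlm)
  (@variation_from_nondecreasing _ a b dfm)
  (Nlm_nondec lm_noninc) s1 s2 s3 eq0 xab yab => /= h.
have E : \int[mum]_(u in `]a, y[) (fp u / lp u) =
    \int[mum]_(u in `]a, x[) (fp u / lp u) + \int[mum]_(u in `]x, y[) (fp u / lp u).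
  by apply: (itv_integral_split hab mumL) => //; rewrite xy (itvP xab).
rewrite E in h; lra.
Qed.

Lemma fp_increment : {in `[a, b] &, forall x y, (x <= y)%E ->
  \int[mup]_(u in `]x, y[) (fm u / lm u) = fp x - fp y}.
Proof.
move=> x y xab yab xy.
have [_ _ [dlm [dlp [dfm [dfp [[_ hlp] [_ hfp] eq1 _]]]]] _] := hf.
have [M fM] := fm_bounded.
have i := div_fm_integrable mup.
have s1 := charge_stieltjes hlp fm_continuous fM.
have s2 := charge_stieltjes hfp lm_cont lm_bounded.
have s3 := itv_integral_stieltjesl hab mupL i (fun u _ => erefl).
have eq0 : {in `[a, b], forall u, charge_integral dlp `]a, u]%classic fm +
    charge_integral dfp `]a, u]%classic lm = 0}.
  by move=> u uab; apply: eq1; [exact: emeasurable_itv|exact: sub_itv].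
have := differential_ratio fm_continuous lm_cont lm0
  (@variation_from_nondecreasing _ a b dlp)
  (@variation_from_nondecreasing _ a b dfp)
  lp_nondec s1 s2 s3 eq0 xab yab => /= h.
have E : \int[mup]_(u in `]a, y[) (fm u / lm u) =
    \int[mup]_(u in `]a, x[) (fm u / lm u) + \int[mup]_(u in `]x, y[) (fm u / lm u).
  by apply: (itv_integral_split hab mupL) => //; rewrite xy (itvP xab).
rewrite E in h; lra.
Qed.

Lemma luckock_solution_pair : luckock_pair a b lm lp fm fp.
Proof.
split; [exact: fm_continuous|exact: fp_continuous| |].
- have s := itv_integral_stieltjesl hab mumL (div_fp_integrable mum) (fun u _ => erefl).
  apply: (stieltjes_shift (c := fm a) s) => x xab.
  by rewrite fm_increment ?(itvP xab)// subrK.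
- have s := itv_integral_stieltjesl hab mupL (div_fm_integrable mup) (fun u _ => erefl).
  apply: (stieltjes_shift (c := - fp a) s) => x xab.
  by rewrite fp_increment ?(itvP xab)// addrC addKr.
Qed.

End solution.
End luckock_solutions.

Section weights.
Context (R : realType) (a b : \bar R).
Hypothesis hab : (a < b)%E.
Implicit Types (f g w : \bar R -> R) (x y z : \bar R).

Let aI : a \in `[a, b] := a_itv hab.
Let bI : b \in `[a, b] := b_itv hab.

(** The comparison [u <= z] gives the value at [z] to the left branch, as left-continuity requires;
    the mirror lemma uses [u < z]. *)
Lemma left_continuous_step z f g : {within `[a, b], continuous f} ->
  {within `[a, b], continuous g} -> forall x, x \in `]a, b] ->
  (fun u => if (u <= z)%E then f u else g u) @ within [set y | (y < x)%E] (nbhs x)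
  --> (if (x <= z)%E then f x else g x).
Proof.
move=> /within_left_continuous cf /within_left_continuous cg x xab.
have [xz|zx] := leP x z => U hU.
  have hf : nbhs x [set u | (u < x)%E -> U (f u)] := cf x xab U hU.
  suff : nbhs x [set u | (u < x)%E -> U (if (u <= z)%E then f u else g u)] by [].
  apply: filterS hf => u hu ux /=.
  by rewrite (le_trans (ltW ux) xz); exact: hu.
have hg : nbhs x [set u | (u < x)%E -> U (g u)] := cg x xab U hU.
have hz : nbhs x [set u | (z < u)%E].
  by apply: open_nbhs_nbhs; split; [exact: open_ereal_gt_ereal|].
suff : nbhs x [set u | (u < x)%E -> U (if (u <= z)%E then f u else g u)] by [].
apply: filterS2 hg hz => u hu zu ux /=.
by rewrite leNgt zu; exact: hu.
Qed.

Lemma right_continuous_step z f g : {within `[a, b], continuous f} ->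
  {within `[a, b], continuous g} -> forall x, x \in `[a, b[ ->
  (fun u => if (u < z)%E then f u else g u) @ within [set y | (x < y)%E] (nbhs x)
  --> (if (x < z)%E then f x else g x).
Proof.
move=> /within_right_continuous cf /within_right_continuous cg x xab.
have [xz|zx] := ltP x z => U hU.
  have hf : nbhs x [set u | (x < u)%E -> U (f u)] := cf x xab U hU.
  have hz : nbhs x [set u | (u < z)%E].
    by apply: open_nbhs_nbhs; split; [exact: open_ereal_lt_ereal|].
  suff : nbhs x [set u | (x < u)%E -> U (if (u < z)%E then f u else g u)] by [].
  apply: filterS2 hf hz => u hu uz xu /=.
  by rewrite uz; exact: hu.
have hg : nbhs x [set u | (x < u)%E -> U (g u)] := cg x xab U hU.
suff : nbhs x [set u | (x < u)%E -> U (if (u < z)%E then f u else g u)] by [].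
apply: filterS hg => u hu xu /=.
by rewrite ltNge (le_trans zx (ltW xu)); exact: hu.
Qed.

(** For uniqueness of the minus weight at [b]: [M_-] never equals [b], so the generator does not
    constrain that value. *)
Lemma left_limit_zero x w : (a < x)%E ->
  w @ within [set y | (y < x)%E] (nbhs x) --> w x ->
  (forall y, (a < y < x)%E -> w y = 0) -> w x = 0.
Proof.
move=> ax /cvgrPdist_lt cw w0; apply/eqP/negP => /negP wx.
have e0 : 0 < `|w x| by rewrite normr_gt0.
have := cw _ e0; rewrite near_withinE => nw.
have [y [ay yx /(_ yx) /=]] := nbhs_left_exists nw ax.
by rewrite (w0 y) ?ay// subr0 ltxx.
Qed.

Lemma right_limit_zero x w : (x < b)%E ->
  w @ within [set y | (x < y)%E] (nbhs x) --> w x ->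
  (forall y, (x < y < b)%E -> w y = 0) -> w x = 0.
Proof.
move=> xb /cvgrPdist_lt cw w0; apply/eqP/negP => /negP wx.
have e0 : 0 < `|w x| by rewrite normr_gt0.
have := cw _ e0; rewrite near_withinE => nw.
have [y [xy yb /(_ xy) /=]] := nbhs_right_exists nw xb.
by rewrite (w0 y) ?xy// subr0 ltxx.
Qed.

Variables (lm lp : \bar R -> R).
Hypothesis (lm_cont : {within `[a, b], continuous lm}).
Hypothesis (lp_cont : {within `[a, b], continuous lp}).
Hypothesis (lm_noninc : {in `[a, b] &, forall x y, (x <= y)%E -> lm y <= lm x}).
Hypothesis (lp_nondec : {in `[a, b] &, forall x y, (x <= y)%E -> lp x <= lp y}).
Hypotheses (lp_gt0 : 0 < lp a) (lm_gt0 : 0 < lm b).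
Variables (mum mup : {finite_measure set (\bar R) -> \bar R}).
Hypothesis mumL : {in `[a, b] &, forall x y, (x < y)%E ->
  mum `]x, y[%classic = (- lm y - - lm x)%:E}.
Hypothesis mupL : {in `[a, b] &, forall x y, (x < y)%E ->
  mup `]x, y[%classic = (lp y - lp x)%:E}.
Implicit Types wm wp : \bar R -> R.

Let lm_pos x : x \in `[a, b] -> 0 < lm x.
Proof. exact: lm_itv_gt0 hab lm_noninc lm_gt0 x. Qed.
Let lp_pos x : x \in `[a, b] -> 0 < lp x.
Proof. exact: lp_itv_gt0 hab lp_nondec lp_gt0 x. Qed.
Let lm0 : {in `[a, b], forall x, lm x != 0}.
Proof. by move=> x /lm_pos; rewrite lt0r => /andP[]. Qed.
Let lp0 : {in `[a, b], forall x, lp x != 0}.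
Proof. by move=> x /lp_pos; rewrite lt0r => /andP[]. Qed.

Lemma weights_unique vm vp wm wp :
  weight_functions a b vm vp -> weight_functions a b wm wp ->
  {in `[a, b] &, forall x y, (x < y)%E ->
    minus_rate a lm mum vm vp y + plus_rate b lp mup vm vp x =
    minus_rate a lm mum wm wp y + plus_rate b lp mup wm wp x} ->
  {in `[a, b], vm =1 wm} /\ {in `[a, b], vp =1 wp}.
Proof.
move=> hv hw hvw.
have [ivm _] := weight_functions_integrable mum hv.
have [_ ivp] := weight_functions_integrable mup hv.
have [iwm _] := weight_functions_integrable mum hw.
have [_ iwp] := weight_functions_integrable mup hw.
have [[Mv bv] vl vr vma vpb] := hv; have [[Mw bw] wl wr wma wpb] := hw.
pose dm u := vm u - wm u; pose dp u := vp u - wp u.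
have idm : mum.-integrable `[a, b] (EFin \o dm).
  by apply: integrableB ivm iwm; exact: emeasurable_itv.
have idp : mup.-integrable `[a, b] (EFin \o dp).
  by apply: integrableB ivp iwp; exact: emeasurable_itv.
pose Qm y := \int[mum]_(u in `]a, y[) dm u - dp y * lm y.
pose Qp x := \int[mup]_(u in `]x, b[) dp u - dm x * lp x.
have QmE y : y \in `[a, b] -> Qm y =
    minus_rate a lm mum vm vp y - minus_rate a lm mum wm wp y.
  move=> yab; rewrite /Qm /minus_rate /dm /dp RintegralB//; first ring.
  - exact: itv_integrable ivm aI yab.
  - exact: itv_integrable iwm aI yab.
have QpE x : x \in `[a, b] -> Qp x =
    plus_rate b lp mup vm vp x - plus_rate b lp mup wm wp x.
  move=> xab; rewrite /Qp /plus_rate /dm /dp RintegralB//; first ring.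
  - exact: itv_integrable ivp xab bI.
  - exact: itv_integrable iwp xab bI.
have Q0 x y : x \in `[a, b] -> y \in `[a, b] -> (x < y)%E -> Qm y + Qp x = 0.
  by move=> xab yab xy; rewrite QmE// QpE//; have := hvw x y xab yab xy; lra.
pose C := Qm b.
(* Pairing [y] with [x = a], and [x] with [y = b], separates the variables: a function of [y] plus a
   function of [x] that sum to 0 are opposite constants. *)
have QmC y : y \in `[a, b] -> (a < y)%E -> Qm y = C.
  move=> yab ay; have := Q0 a y aI yab ay; have := Q0 a b aI bI hab.
  by rewrite /C; lra.
have QpC x : x \in `[a, b] -> (x < b)%E -> Qp x = - C.
  by move=> xab xb; have := Q0 x b xab bI xb; rewrite /C; lra.
(* [f] and [g] are defined through integrals and not as [dp * lm] and [dm * lp]: the two versions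
   may differ at [a] for [f] and at [b] for [g], and the integrals are continuous up to both
   ends. *)
pose f y := \int[mum]_(u in `]a, y[) dm u - C.
pose g x := \int[mup]_(u in `]x, b[) dp u + C.
have fE y : y \in `[a, b] -> (a < y)%E -> f y = dp y * lm y.
  by move=> yab ay; have := QmC y yab ay; rewrite /Qm /f; lra.
have gE x : x \in `[a, b] -> (x < b)%E -> g x = dm x * lp x.
  by move=> xab xb; have := QpC x xab xb; rewrite /Qp /g; lra.
have oo_itv u : u \in `]a, b[ -> [/\ u \in `[a, b], (a < u)%E & (u < b)%E].
  by rewrite !in_itv/= => /andP[au ub]; rewrite !ltW.
have sf w' : {in `]a, b[, dm =1 w'} ->
    stieltjes a b w' (fun x => - lm x) (fun x => - lm x) f.
  by move=> dw; apply: stieltjes_shift (itv_integral_stieltjesl hab mumL idm dw) _.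
have sg w' : {in `]a, b[, dp =1 w'} -> stieltjes a b w' lp lp (fun x => - g x).
  move=> dw; apply: (stieltjes_shift (c := - C)
    (itv_integral_stieltjesr hab mupL idp dw)) => x _.
  by rewrite /g opprD.
have pair : luckock_pair a b lm lp f g.
  split.
  - apply: (stieltjes_continuous (lm_within lm_cont) (Nlm_nondec lm_noninc) _
      (sf dm (fun _ _ => erefl))) => x xab.
    by apply: (le_trans (ler_normB _ _)); apply: lerD;
      [exact: (bv x xab).1|exact: (bw x xab).1].
  - have cNg : {within `[a, b], continuous (fun x => - g x)}.
      apply: (stieltjes_continuous lp_cont lp_nondec _
        (sg dp (fun _ _ => erefl))) => x xab.
      by apply: (le_trans (ler_normB _ _)); apply: lerD;
        [exact: (bv x xab).2|exact: (bw x xab).2].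
    have -> : g = (fun x => - - g x) by apply/funext => x; rewrite opprK.
    by move=> x; apply: cvgN; exact: cNg.
  - apply: sf => u /oo_itv[uab au ub].
    by rewrite gE// mulfK ?lp0.
  - apply: sg => u /oo_itv[uab au ub].
    by rewrite fE// mulfK ?lm0.
have fb : f b = 0 by rewrite fE// /dp vpb wpb subrr mul0r.
have ga : g a = 0 by rewrite gE// /dm vma wma subrr mul0r.
have fg0 := luckock_pair_zero hab lm_cont lp_cont lm_noninc lp_nondec
  lp_gt0 lm_gt0 pair fb ga.
have dp0 y : y \in `[a, b] -> (a < y)%E -> dp y = 0.
  move=> yab ay; have [+ _] := fg0 y yab; rewrite fE// => /eqP.
  by rewrite mulf_eq0 (negbTE (lm0 yab)) orbF => /eqP.
have dm0 x : x \in `[a, b] -> (x < b)%E -> dm x = 0.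
  move=> xab xb; have [_] := fg0 x xab; rewrite gE// => /eqP.
  by rewrite mulf_eq0 (negbTE (lp0 xab)) orbF => /eqP.
split=> x xab; apply/eqP; rewrite -subr_eq0; apply/eqP.
- rewrite -/(dm x); have [xb|xb] := eqVneq x b; last first.
    by apply: dm0 => //; rewrite lt_neqAle xb (itvP xab).
  rewrite xb; apply: (left_limit_zero hab).
    by apply: cvgB; [apply: vl|apply: wl]; rewrite in_itv/= hab lexx.
  by move=> y /andP[ay yb]; apply: dm0 => //; rewrite in_itv/= !ltW.
- rewrite -/(dp x); have [xa|xa] := eqVneq x a; last first.
    by apply: dp0 => //; rewrite lt_neqAle eq_sym xa (itvP xab).
  rewrite xa; apply: (right_limit_zero hab).
    by apply: cvgB; [apply: vr|apply: wr]; rewrite in_itv/= hab lexx.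
  by move=> y /andP[ay yb]; apply: dp0 => //; rewrite in_itv/= !ltW.
Qed.

Variables (fm fp : \bar R -> R).
Hypothesis hf : luckock_solution a b lm lp fm fp.

Let cfm := fm_continuous hf.
Let cfp := fp_continuous hf.

(* To the left and to the right of [z] the weights are multiples of the
   solutions [fp / lp - 1 / lp a] and [fp / lp + 1 / lm b], which satisfy the
   boundary condition at [a] and that at [b]; the coefficients [b1] and [b2]
   prescribe the jumps at [z]. *)
Definition step_weight_minus z (b1 b2 : R) u : R :=
  if (u <= z)%E then b1 * (fp u / lp u + - (lp a)^-1)
  else b2 * (fp u / lp u + (lm b)^-1).

Definition step_weight_plus z (b1 b2 : R) u : R :=
  if (u < z)%E then b1 * (fm u / lm u + (lp a)^-1)
  else b2 * (fm u / lm u + - (lm b)^-1).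

Let branch_continuous g (c k : R) : {within `[a, b], continuous g} ->
  {within `[a, b], continuous (fun u => c * (g u + k))}.
Proof.
move=> cg x; apply: cvgM; first exact: cvg_cst.
by apply: cvgD; [exact: cg|exact: cvg_cst].
Qed.

Let branch_bounded (c k M x : R) : `|x| <= M -> `|c * (x + k)| <= `|c| * (M + `|k|).
Proof.
move=> xM; rewrite normrM ler_wpM2l// (le_trans (ler_normD _ _))// lerD2r//.
Qed.

Let fa : fp a = 1. Proof. by have [_ _ _ []] := hf. Qed.
Let fb : fm b = 1. Proof. by have [_ _ _ []] := hf. Qed.

Let cgp : {within `[a, b], continuous (fun u => fp u / lp u)}.
Proof. exact: within_div cfp lp_cont lp0. Qed.
Let cgm : {within `[a, b], continuous (fun u => fm u / lm u)}.
Proof. exact: within_div cfm lm_cont lm0. Qed.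

Lemma step_weight_functions z b1 b2 : z \in `[a, b] ->
  weight_functions a b (step_weight_minus z b1 b2) (step_weight_plus z b1 b2).
Proof.
move=> zab; split.
- have [Mm hMm] := fm_bounded hab hf; have [Mp hMp] := fp_bounded hab hf.
  have bm := div_lm_bounded hab lm_noninc lm_gt0 hMm.
  have bp := div_lp_bounded hab lp_nondec lp_gt0 hMp.
  set Nm := Mm / _ in bm; set Np := Mp / _ in bp.
  set r := (lp a)^-1; set q := (lm b)^-1.
  exists (`|b1| * (Np + `|- r|) + `|b2| * (Np + `|q|) +
          (`|b1| * (Nm + `|r|) + `|b2| * (Nm + `|- q|))) => x xab.
  have Np0 : 0 <= Np := le_trans (normr_ge0 _) (bp x xab).
  have Nm0 : 0 <= Nm := le_trans (normr_ge0 _) (bm x xab).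
  have pos (c k N : R) : 0 <= N -> 0 <= `|c| * (N + `|k|).
    by move=> N0; rewrite mulr_ge0// addr_ge0.
  have h1 := pos b1 (- r) Np Np0; have h2 := pos b2 q Np Np0.
  have h3 := pos b1 r Nm Nm0; have h4 := pos b2 (- q) Nm Nm0.
  rewrite /step_weight_minus /step_weight_plus -/r -/q; split; case: ifP => _.
  + by have := branch_bounded b1 (- r) (bp x xab); lra.
  + by have := branch_bounded b2 q (bp x xab); lra.
  + by have := branch_bounded b1 r (bm x xab); lra.
  + by have := branch_bounded b2 (- q) (bm x xab); lra.
- exact: (left_continuous_step (z := z) (@branch_continuous _ b1 (- (lp a)^-1) cgp)
    (@branch_continuous _ b2 (lm b)^-1 cgp)).
- exact: (right_continuous_step (z := z) (@branch_continuous _ b1 (lp a)^-1 cgm)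
    (@branch_continuous _ b2 (- (lm b)^-1) cgm)).
- by rewrite /step_weight_minus (itvP zab) fa div1r subrr mulr0.
- by rewrite /step_weight_plus ltNge (itvP zab) fb div1r subrr mulr0.
Qed.

Let integral_branch (m : {finite_measure set (\bar R) -> \bar R})
    (L g h : \bar R -> R) (c k : R) x y :
  {in `[a, b] &, forall x y, (x < y)%E -> m `]x, y[%classic = (L y - L x)%:E} ->
  m.-integrable `[a, b] (EFin \o g) ->
  x \in `[a, b] -> y \in `[a, b] -> (x <= y)%E ->
  (forall u, (x < u < y)%E -> h u = c * (g u + k)) ->
  \int[m]_(u in `]x, y[) h u =
  c * (\int[m]_(u in `]x, y[) g u + k * (L y - L x)).
Proof.
move=> mL ig xab yab xy hE.
have mI : measurable `]x, y[%classic by exact: emeasurable_itv.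
have ig' := itv_integrable ig xab yab.
have ik : m.-integrable `]x, y[ (EFin \o (fun=> k)).
  apply: measurable_bounded_integrable => //.
    by rewrite ltey_eq fin_num_measure.
  exact: (@bounded_on _ _ _ _ `|k|).
have igk : m.-integrable `]x, y[ (EFin \o (fun u => g u + k)).
  exact: (integrableD mI ig' ik).
rewrite (@eq_Rintegral _ _ _ _ _ (fun u => c * (g u + k))); last first.
  by move=> u; rewrite inE /= in_itv/= => /hE.
rewrite RintegralZl// RintegralD// Rintegral_cst//.
by rewrite (itv_measureE mL).
Qed.

Let integrals_increment : {in `[a, b] &, forall x y, (x <= y)%E ->
  \int[mum]_(u in `]x, y[) (fp u / lp u) = fm y - fm x /\
  \int[mup]_(u in `]x, y[) (fm u / lm u) = fp x - fp y}.
Proof.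
move=> x y xab yab xy; split.
  exact: (fm_increment hab lp_cont lm_noninc lp_nondec lp_gt0 mumL hf xab yab xy).
exact: (fp_increment hab lm_cont lm_noninc lp_nondec lm_gt0 mupL hf xab yab xy).
Qed.

(** On each side of [z] the weights come from a solution of Luckock's equation, so the rate is
    constant there. The integral term varies continuously in [y]; the jump at [z] is the change of
    [w_+ * lm] between the two branches. *)
Lemma minus_rate_step z b1 b2 y : z \in `[a, b] -> y \in `[a, b] ->
  minus_rate a lm mum (step_weight_minus z b1 b2) (step_weight_plus z b1 b2) y =
  - (b1 * (fm a + lm a / lp a)) +
  ((z <= y)%E)%:R * (b1 * (fm z + lm z / lp a) - b2 * (fm z - lm z / lm b)).
Proof.
move=> zab yab; rewrite /minus_rate.
have im := div_fp_integrable hab lp_cont lp_nondec lp_gt0 hf mum.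
have [iw _] := weight_functions_integrable mum (step_weight_functions b1 b2 zab).
have lmy := lm0 yab; have lmb := lm0 bI; have lpa := lp0 aI.
have left x u : (a <= x)%E -> x \in `[a, b] ->
    u \in `[a, b] -> (x <= u)%E -> (u <= z)%E ->
    \int[mum]_(v in `]x, u[) step_weight_minus z b1 b2 v =
    b1 * (fm u - fm x - (lp a)^-1 * (lm x - lm u)).
  move=> ax xab uab xu uz.
  rewrite (integral_branch (c := b1) (k := - (lp a)^-1) mumL im)//; last first.
    by move=> v /andP[_ vu]; rewrite /step_weight_minus (le_trans (ltW vu) uz).
  by rewrite (integrals_increment xab uab xu).1; ring.
have [zy|yz] := leP z y; last first.
  rewrite left ?(itvP yab) ?(ltW yz)// /step_weight_plus yz mul0r addr0.
  by field; rewrite lmy lpa.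
rewrite (itv_integral_split hab mumL iw (t := z)) ?(itvP zab)//.
rewrite left ?(itvP zab)//.
rewrite (integral_branch (c := b2) (k := (lm b)^-1) mumL im)//; last first.
  by move=> v /andP[zv _]; rewrite /step_weight_minus leNgt zv.
rewrite (integrals_increment zab yab zy).1 /step_weight_plus ltNge zy/=.
by field; rewrite lmy lpa lmb.
Qed.

Lemma plus_rate_step z b1 b2 x : z \in `[a, b] -> x \in `[a, b] ->
  plus_rate b lp mup (step_weight_minus z b1 b2) (step_weight_plus z b1 b2) x =
  - (b2 * (fp b + lp b / lm b)) +
  ((x <= z)%E)%:R * (b2 * (fp z + lp z / lm b) - b1 * (fp z - lp z / lp a)).
Proof.
move=> zab xab; rewrite /plus_rate.
have ip := div_fm_integrable hab lm_cont lm_noninc lm_gt0 hf mup.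
have [_ iw] := weight_functions_integrable mup (step_weight_functions b1 b2 zab).
have lpx := lp0 xab; have lmb := lm0 bI; have lpa := lp0 aI.
have right u : u \in `[a, b] -> (z <= u)%E ->
    \int[mup]_(v in `]u, b[) step_weight_plus z b1 b2 v =
    b2 * (fp u - fp b - (lm b)^-1 * (lp b - lp u)).
  move=> uab zu.
  rewrite (integral_branch (c := b2) (k := - (lm b)^-1) mupL ip)
    ?(itvP uab)//; last first.
    by move=> v /andP[uv _]; rewrite /step_weight_plus ltNge (le_trans zu (ltW uv)).
  by rewrite (integrals_increment uab bI _).2 ?(itvP uab)//; ring.
have [xz|zx] := leP x z; last first.
  rewrite right ?(ltW zx)// /step_weight_minus leNgt zx mul0r addr0/=.
  by field; rewrite lpx lmb.
rewrite (itv_integral_split hab mupL iw (t := z)) ?xz ?(itvP zab)//.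
rewrite right//.
rewrite (integral_branch (c := b1) (k := (lp a)^-1) mupL ip)//; last first.
  by move=> v /andP[_ vz]; rewrite /step_weight_plus vz.
rewrite (integrals_increment xab zab xz).2 /step_weight_minus xz/=.
by field; rewrite lpx lpa lmb.
Qed.

(** [A] and [B] are the jump heights in [M_+] and in [M_-], so both targets come from one
    construction. *)
Lemma weights_exist z (A B : R) : z \in `[a, b] ->
  exists wm wp, weight_functions a b wm wp /\
    {in `[a, b] &, forall x y,
      minus_rate a lm mum wm wp y + plus_rate b lp mup wm wp x =
      A * (((z <= y)%E)%:R - fp z) + B * (((x <= z)%E)%:R - fm z)}.
Proof.
move=> zab.
have pair := luckock_solution_pair hab lm_cont lp_cont lm_noninc lp_nondec
  lp_gt0 lm_gt0 mumL mupL hf.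
have Kpos := luckock_pair_pos hab lm_cont lp_cont lm_noninc lp_nondec
  lp_gt0 lm_gt0 pair fb fa zab.
have KE := luckock_pair_constant hab lm_cont lp_cont lm_noninc lp_nondec
  lp_gt0 lm_gt0 pair.
have Ka := KE a z aI zab; have Kb := KE b z bI zab.
set K := fm z * lp z + fp z * lm z in Kpos Ka Kb.
rewrite fa mul1r in Ka; rewrite fb mul1r in Kb.
have la := lp0 aI; have lb := lm0 bI.
pose rq := (lp a)^-1 + (lm b)^-1.
have rq0 : 0 < rq by rewrite addr_gt0 ?invr_gt0.
(* Cramer's rule for [jumpA] and [jumpB] below; the determinant simplifies to [rq * K]. *)
pose b1 := (A * (lp z / lm b + fp z) - B * (lm z / lm b - fm z)) / (rq * K).
pose b2 := (B * (lm z / lp a + fm z) - A * (lp z / lp a - fp z)) / (rq * K).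
exists (step_weight_minus z b1 b2), (step_weight_plus z b1 b2).
split=> [|x y xab yab]; first exact: step_weight_functions.
rewrite minus_rate_step// plus_rate_step//.
have fmaE : fm a = (K - lm a) / lp a by rewrite -Ka addrK mulfK.
have fpbE : fp b = (K - lp b) / lm b.
  by rewrite -Kb [lp b + _]addrC addrK mulfK.
have rqE : rq * (lp a * lm b) = lm b + lp a by rewrite /rq; field; rewrite la lb.
have s0 : lm b + lp a != 0 by rewrite gt_eqF// addr_gt0.
have K0 : K != 0 by rewrite gt_eqF.
have jumpA : b1 * (fm z + lm z / lp a) - b2 * (fm z - lm z / lm b) = A.
  by rewrite /b1 /b2 /rq; rewrite /K in K0 *; field; rewrite K0 s0 la lb.
have jumpB : b2 * (fp z + lp z / lm b) - b1 * (fp z - lp z / lp a) = B.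
  by rewrite /b1 /b2 /rq; rewrite /K in K0 *; field; rewrite K0 s0 la lb.
(* The brackets are [K / lp a] and [K / lm b], the first integral read at the two ends; hence the
   constant parts of the rates add up to the required one. *)
have bnd : b1 * (fm a + lm a / lp a) + b2 * (fp b + lp b / lm b) =
    A * fp z + B * fm z.
  rewrite fmaE fpbE /b1 /b2 /rq; field; by rewrite K0 s0 la lb.
rewrite jumpA jumpB; move: bnd; lra.
Qed.

End weights.

Unset Implicit Arguments.

Theorem theorem9 (R : realType) (a b : \bar R) (lm lp fm fp : \bar R -> R)
    (mu : {measure set (\bar R * bool) -> \bar R})
    (hab : (a < b)%E)
    (lm_cont : {within `[a, b], continuous lm})
    (lp_cont : {within `[a, b], continuous lp})
    (lm_ge0 : forall x, x \in `[a, b] -> 0 <= lm x)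
    (lp_ge0 : forall x, x \in `[a, b] -> 0 <= lp x)
    (lm_noninc : {in `[a, b] &, forall x y, (x <= y)%E -> lm y <= lm x})
    (lp_nondec : {in `[a, b] &, forall x y, (x <= y)%E -> lp x <= lp y})
    (lp_gt0 : 0 < lp a) (lm_gt0 : 0 < lm b)
    (hf : luckock_solution a b lm lp fm fp)
    (hmu : is_order_measure a b lm lp mu)
    (z : \bar R) (hz : z \in `[a, b]) :
  exists_unique_weights a b (fun wm wp =>
    forall X, Sord_fin a b X ->
      generator a b mu (linear_functional a b wm wp) X =
        ((Mminus a b X <= z)%E)%:R - fm z) /\
  exists_unique_weights a b (fun wm wp =>
    forall X, Sord_fin a b X ->
      generator a b mu (linear_functional a b wm wp) X =
        ((z <= Mplus a b X)%E)%:R - fp z).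
Proof.
have [mum [mup [_ mumE mupE muE]]] := hmu.
have mumL := closed_left_measureE lm_cont mumE.
have mupL := closed_right_measureE lp_cont mupE.
have unique (target : {charge set (\bar R) -> \bar R} -> R) wm wp :
    weight_functions a b wm wp ->
    (forall X, Sord_fin a b X ->
      generator a b mu (linear_functional a b wm wp) X = target X) ->
    forall vm vp, weight_functions a b vm vp ->
    (forall X, Sord_fin a b X ->
      generator a b mu (linear_functional a b vm vp) X = target X) ->
    {in `[a, b], vm =1 wm} /\ {in `[a, b], vp =1 wp}.
  move=> hw Gw vm vp hv Gv.
  apply: (weights_unique hab lm_cont lp_cont lm_noninc lp_nondec lp_gt0 lm_gt0
    mumL mupL hv hw) => x y xab yab xy.
  have [X [SX <- <-]] := configuration_exists xab yab xy.
  rewrite -(generatorE hab mumE mupE muE hv SX) Gv//.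
  by rewrite -(generatorE hab mumE mupE muE hw SX) Gw.
have exist (A B : R) : exists wm wp, weight_functions a b wm wp /\
    forall X, Sord_fin a b X ->
      generator a b mu (linear_functional a b wm wp) X =
      A * (((z <= Mplus a b X)%E)%:R - fp z) +
      B * (((Mminus a b X <= z)%E)%:R - fm z).
  have [wm [wp [hw rates]]] := weights_exist hab lm_cont lp_cont lm_noninc
    lp_nondec lp_gt0 lm_gt0 mumL mupL hf A B hz.
  exists wm, wp; split=> // X SX; rewrite (generatorE hab mumE mupE muE hw SX).
  have /Sord_finP[sp [sm rX]] := SX.
  exact: rates (Mminus_itv hab rX) (Mplus_itv hab rX).
split.
(* A unit jump in [M_-] only; the second claim takes a unit jump in [M_+] only. *)
- have [wm [wp [hw G]]] := exist 0 1.
  have {}G X : Sord_fin a b X ->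
      generator a b mu (linear_functional a b wm wp) X =
      ((Mminus a b X <= z)%E)%:R - fm z.
    by move=> /G ->; rewrite mul0r add0r mul1r.
  by exists wm, wp; split=> //; exact: unique hw G.
- have [wm [wp [hw G]]] := exist 1 0.
  have {}G X : Sord_fin a b X ->
      generator a b mu (linear_functional a b wm wp) X =
      ((z <= Mplus a b X)%E)%:R - fp z.
    by move=> /G ->; rewrite mul0r addr0 mul1r.
  by exists wm, wp; split=> //; exact: unique hw G.
Qed.
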